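(* Let $\mathcal K$ be an infinite-dimensional separable Hilbert space and suppose that all the multiplicity spaces $\mathcal H_p^\circ$, $p\in\mathbf P$, are finite dimensional. Then for every linear operator $$M^\circ:\ \mathcal H^\circ_{\mathbf S}=\bigoplus_{p\in\mathbf P}\big(\mathbb C^{\mathbf S_p}\otimes\mathcal H_p^\circ\big)\ \to\ \mathcal H^\circ_{\mathbf R}=\bigoplus_{p\in\mathbf P}\big(\mathbb C^{\mathbf R_p}\otimes\mathcal H_p^\circ\big)$$ one has $$\widetilde\mu_{\boldsymbol\Delta_{\mathbf G^\circ}}(M^\circ):=\mu_{\boldsymbol\Delta_{\overline{\mathbf G}}}(I_{\mathcal K}\otimes M^\circ)=\widehat\mu_{\boldsymbol\Delta_{\mathbf G^\circ}}(M^\circ).$$ In particular, $\widetilde\mu_{\boldsymbol\Delta_{\mathbf G^\circ}}(M^\circ)<1$ if and only if $\widehat\mu_{\boldsymbol\Delta_{\mathbf G^\circ}}(M^\circ)<1$, and testing whether $\widetilde\mu_{\boldsymbol\Delta_{\mathbf G^\circ}}(M^\circ)<1$ reduces to a finite-dimensional linear matrix inequality: $\widetilde\mu_{\boldsymbol\Delta_{\mathbf G^\circ}}(M^\circ)<1$ if and only if there exist positive definite operators $\Gamma_p\succ0$ on $\mathcal H_p^\circ$ ($p\in\mathbf P$) such that $$(M^\circ)^*\Big(\bigoplus_{p\in\mathbf P} I_{\mathbb C^{\mathbf R_p}}\otimes\Gamma_p\Big)M^\circ-\Big(\bigoplus_{p\in\mathbf P} I_{\mathbb C^{\mathbf S_p}}\otimes\Gamma_p\Big)\prec0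 .$$
   Context: All Hilbert spaces are complex; $\mathcal L(\mathcal H,\mathcal K)$ denotes the bounded linear operators from $\mathcal H$ to $\mathcal K$. Graph data. $G=(\mathbf V,\mathbf E)$ is a finite simple undirected bipartite graph with vertex decomposition $\mathbf V=\mathbf S\sqcup\mathbf R$ (source vertices and range vertices), so every edge joins a vertex of $\mathbf S$ to a vertex of $\mathbf R$. Each path-connected component of $G$ is a complete bipartite graph (having at least one source and at least one range vertex). $\mathbf P$ is the set of path-connected components; for $p\in\mathbf P$, $\mathbf S_p$ and $\mathbf R_p$ are the sets of source and range vertices in $p$. To each $p\in\mathbf P$ a Hilbert space $\mathcal H^\circ_p$ is assigned; $\mathbf G^\circ=(G,\{\mathcal H_p^\circ\}_{p\in\mathbf P})$. Put $\mathcal H^\circ_{\mathbf S}=\bigoplus_{p}\mathbb C^{\mathbf S_p}\otimes\mathcal H^\circ_p$ and $\mathcal H^\circ_{\mathbf R}=\bigoplus_p\mathbb C^{\mathbf R_p}\otimes\mathcal H_p^\circ$. Uncertainty structures. Define $$\boldsymbol\Delta_{\mathbf G^\circ}=\Big\{\bigoplus_{p}W_p\otimes I_{\mathcal H_p^\circ}:\ W_p\in\mathcal L(\mathbb C^{\mathbf R_p},\mathbb C^{\mathbf S_p})\Big\}\subset\mathcal L(\mathcal H^\circ_{\mathbf R},\mathcal H^\circ_{\mathbf S}),$$ and, for the Hilbert space $\mathcal K$, the enhanced structure $$\boldsymbol\Delta_{\overline{\mathbf G}}=\Big\{\bigoplus_pW_p\otimes I_{\mathcal H_p^\circ}:\ W_p\in\mathcal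 L(\mathcal K\otimes\mathbb C^{\mathbf R_p},\mathcal K\otimes\mathbb C^{\mathbf S_p})\Big\}\subset\mathcal L(\mathcal K\otimes\mathcal H^\circ_{\mathbf R},\mathcal K\otimes\mathcal H^\circ_{\mathbf S}),$$ where $\mathcal K\otimes\mathcal H^\circ_{\mathbf R}=\bigoplus_p\mathcal K\otimes\mathbb C^{\mathbf R_p}\otimes\mathcal H_p^\circ$ and similarly for $\mathbf S$. Structured singular value and its upper bound. For a structure $\boldsymbol\Delta\subset\mathcal L(\mathcal X_{\mathbf R},\mathcal X_{\mathbf S})$ and $M\in\mathcal L(\mathcal X_{\mathbf S},\mathcal X_{\mathbf R})$, $$\mu_{\boldsymbol\Delta}(M)=\frac1{\inf\{\|\Delta\|:\ \Delta\in\boldsymbol\Delta,\ 1\in\sigma(M\Delta)\}}$$ ($\sigma$ = spectrum; the value is $0$ if the set is empty), and $$\widehat\mu_{\boldsymbol\Delta}(M)=\inf\{\|XMY^{-1}\|:\ (X,Y)\in\boldsymbol\Delta',\ X,Y\text{ invertible}\},$$ where $\boldsymbol\Delta'=\{(X,Y)\in\mathcal L(\mathcal X_{\mathbf R})\times\mathcal L(\mathcal X_{\mathbf S}):\ \Delta X=Y\Delta\ \text{for all }\Delta\in\boldsymbol\Delta\}$. For $\boldsymbol\Delta_{\mathbf G^\circ}$ the set $\boldsymbol\Delta'_{\mathbf G^\circ}$ consists of the pairs $X=\bigoplus_pI_{\mathbb C^{\mathbf R_p}}\otimes\Gamma_p$, $Y=\bigoplus_pI_{\mathbb C^{\mathbf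 S_p}}\otimes\Gamma_p$ with $\Gamma_p\in\mathcal L(\mathcal H_p^\circ)$. *)

(* Defs.v *)
From HB Require Import structures.
From mathcomp Require Import all_boot all_order all_algebra ring.
From mathcomp Require Import sesquilinear complex.
From mathcomp Require Import boolp classical_sets functions cardinality reals.
From mathcomp Require Import topology normedtype.

Set Implicit Arguments.
Unset Strict Implicit.
Unset Printing Implicit Defensive.
Import Order.TTheory GRing.Theory Num.Theory.
Import numFieldNormedType.Exports.

Local Open Scope complex_scope.
Local Open Scope classical_set_scope.
Local Open Scope ring_scope.

Section DotNorm.
Variables (C : numClosedFieldType) (U : lmodType C).
Variable form : {dot U for Num.conj : C -> C}.

Local Notation "''[' u , v ]" := (form u v).
Local Notation "''[' u ]" := '[u, u].

Lemma dot_CauchySchwarz u v : `|'[u, v]| ^+ 2 <= '[u] * '[v].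
Proof.
have [->|nz_v] := eqVneq v 0.
  by rewrite !linear0r normr0 expr0n mulr0.
pose w := '[v] *: u - '[u, v] *: v.
have := dnorm_ge0 form w.
have v0 : 0 < '[v] by rewrite dnorm_gt0.
have vC : Num.conj '[v] = '[v] by rewrite conj_Creal// gtr0_real.
have vu : '[v, u] = Num.conj '[u, v] by rewrite hermC/= expr0 mul1r.
have -> : '[w] = '[v] * ('[u] * '[v] - `|'[u, v]| ^+ 2).
  rewrite /w linearBl/= !linearBr/= !linearZl_LR/= !linearZr_LR/= vC vu normCK.
  by ring.
by rewrite pmulr_rge0// subr_ge0.
Qed.

Lemma dot_triangle u v :
  sqrtC '[u + v] <= sqrtC '[u] + sqrtC '[v].
Proof.
rewrite -(@ler_pXn2r _ 2)// ?nnegrE ?addr_ge0 ?sqrt_dnorm_ge0//.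
have uvE : '[u, v] + Num.conj '[u, v] = ('Re '[u, v]) *+ 2.
  by rewrite -mulr_natr ReE -mulrA mulVf ?mulr1// pnatr_eq0.
rewrite sqrtCK sqrrD !sqrtCK dnormD/= uvE -addrA [X in _ <= X]addrAC addrA.
rewrite lerD2l lerMn2r/=.
apply: (le_trans (leif_Re_Creal _)).
rewrite -(@ler_pXn2r _ 2)// ?nnegrE ?mulr_ge0 ?sqrt_dnorm_ge0//.
by rewrite exprMn !sqrtCK dot_CauchySchwarz.
Qed.

End DotNorm.

(** Hilbert spaces are complex; [hdot] is linear in its first argument. *)
HB.mixin Record CompleteNormedModule_isHilbert (R : realType) V
    of CompleteNormedModule R[i] V := {
  hdot : {dot V for Num.conj : R[i] -> R[i]};
  hdot_norm : forall x : V, hdot x x = `|x| ^+ 2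
}.

#[short(type="hilbertType")]
HB.structure Definition Hilbert (R : realType) :=
  {V of CompleteNormedModule_isHilbert R V & CompleteNormedModule R[i] V}.

(** The orthogonal direct sum of a finite family of Hilbert spaces. *)
Section HilbertSum.
Variables (R : realType) (I : finType) (X : I -> hilbertType R).

Definition hsum : Type := forall i, X i.

HB.instance Definition _ := Choice.on hsum.

Let hadd (x y : hsum) : hsum := fun i => x i + y i.
Let hopp (x : hsum) : hsum := fun i => - x i.
Let hzero : hsum := fun i => 0.
Let hscale (c : R[i]) (x : hsum) : hsum := fun i => c *: x i.

Fact hsum_addA : associative hadd.
Proof. by move=> x y z; apply: functional_extensionality_dep => i; apply: addrA. Qed.
Fact hsum_addC : commutative hadd.
Proof. by move=> x y; apply: functional_extensionality_dep => i; apply: addrC. Qed.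
Fact hsum_add0 : left_id hzero hadd.
Proof. by move=> x; apply: functional_extensionality_dep => i; apply: add0r. Qed.
Fact hsum_addN : left_inverse hzero hopp hadd.
Proof. by move=> x; apply: functional_extensionality_dep => i; apply: addNr. Qed.

HB.instance Definition _ :=
  GRing.isZmodule.Build hsum hsum_addA hsum_addC hsum_add0 hsum_addN.

Fact hsum_scaleA a b (x : hsum) : hscale a (hscale b x) = hscale (a * b) x.
Proof. by apply: functional_extensionality_dep => i; apply: scalerA. Qed.
Fact hsum_scale1 : left_id 1 hscale.
Proof. by move=> x; apply: functional_extensionality_dep => i; apply: scale1r. Qed.
Fact hsum_scaleDr : right_distributive hscale +%R.
Proof. by move=> a x y; apply: functional_extensionality_dep => i; apply: scalerDr. Qed.
Fact hsum_scaleDl (x : hsum) : {morph hscale^~ x : a b / a + b}.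
Proof. by move=> a b; apply: functional_extensionality_dep => i; apply: scalerDl. Qed.

HB.instance Definition _ := GRing.Zmodule_isLmodule.Build R[i] hsum
  hsum_scaleA hsum_scale1 hsum_scaleDr hsum_scaleDl.

Definition hsum_dot (x y : hsum) : R[i] := \sum_i hdot (x i) (y i).

Fact hsum_dot_bilinear :
  bilinear_for ( *%R : R[i] -> _ -> _) (Num.conj \; *%R) hsum_dot.
Proof.
split=> z a x y; rewrite /hsum_dot /= mulr_sumr -big_split; apply: eq_bigr => i _ /=.
  by rewrite linearPl.
by rewrite linearPr.
Qed.

HB.instance Definition _ := @bilinear_isBilinear.Build R[i] hsum hsum R[i]
  *%R (Num.conj \; *%R) hsum_dot hsum_dot_bilinear.

Fact hsum_dot_hermitian (x y : hsum) :
  hsum_dot x y = (-1) ^+ false * Num.conj (hsum_dot y x).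
Proof.
rewrite expr0 mul1r rmorph_sum; apply: eq_bigr => i _.
by rewrite hermC expr0 mul1r.
Qed.

HB.instance Definition _ :=
  @isHermitianSesquilinear.Build R[i] hsum false Num.conj hsum_dot
    hsum_dot_hermitian.

Fact hsum_dot_gt0 (x : hsum) : x != 0 -> 0 < hsum_dot x x.
Proof.
move=> x0; have [i xi0] : exists i, x i != 0.
  apply/existsP; apply: contraNT x0; rewrite negb_exists => /forallP x0.
  apply/eqP/functional_extensionality_dep => i.
  by have /negPn/eqP := x0 i.
rewrite /hsum_dot (bigD1 i)//= ltr_wpDr ?dnorm_gt0//.
by apply: sumr_ge0 => j _; exact: dnorm_ge0.
Qed.

HB.instance Definition _ :=
  @isDotProduct.Build R[i] hsum hsum_dot hsum_dot_gt0.

Definition hsum_norm (x : hsum) : R[i] := sqrtC (hsum_dot x x).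

Fact hsum_normD x y : hsum_norm (x + y) <= hsum_norm x + hsum_norm y.
Proof. exact: dot_triangle. Qed.
Fact hsum_normZ c x : hsum_norm (c *: x) = `|c| * hsum_norm x.
Proof.
by rewrite /hsum_norm dnormZ sqrtCM ?nnegrE ?exprn_ge0 ?dnorm_ge0// sqrCK.
Qed.
Fact hsum_norm0_eq0 x : hsum_norm x = 0 -> x = 0.
Proof. by move/eqP; rewrite sqrt_dnorm_eq0 => /eqP. Qed.

HB.instance Definition _ := Lmodule_isNormed.Build R[i] hsum
  hsum_normD hsum_normZ hsum_norm0_eq0.

Lemma hsum_normE (x : hsum) : `|x| ^+ 2 = \sum_i `|x i| ^+ 2.
Proof.
rewrite -[`|x|]/(hsum_norm x) sqrtCK; apply: eq_bigr => i _.
exact: hdot_norm.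
Qed.

Lemma hsum_norm_coord (x : hsum) i : `|x i| <= `|x|.
Proof.
rewrite -(@ler_pXn2r _ 2)// ?nnegrE// hsum_normE (bigD1 i)//= lerDl.
by rewrite sumr_ge0// => j _; rewrite exprn_ge0.
Qed.

Lemma hsum_norm_le (x : hsum) : `|x| <= \sum_i `|x i|.
Proof.
rewrite -(@ler_pXn2r _ 2)// ?nnegrE ?sumr_ge0// hsum_normE expr2 mulr_suml.
apply: ler_sum => i _; rewrite expr2 ler_wpM2l// (bigD1 i)//= lerDl.
by rewrite sumr_ge0.
Qed.

Fact hsum_complete (F : set_system hsum) : ProperFilter F -> cauchy F -> cvg F.
Proof.
move=> FF /cauchy_ballP cF.
have ci i : cauchy ((fun x : hsum => x i) @ F).
  apply/cauchy_ballP => e e0; have := cF _ e0.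
  case=> -[A B] /= [FA FB] AB.
  exists ([set x i | x in A], [set x i | x in B]) => /=.
    by split; [apply: filterS FA|apply: filterS FB] => x Ax; exists x.
  move=> [_ _] [/= [x Ax <-] [y By <-]].
  have := AB (x, y) (conj Ax By); rewrite -!ball_normE/=.
  exact/le_lt_trans/(hsum_norm_coord (x - y)).
pose l : hsum := fun i => lim ((fun x : hsum => x i) @ F).
apply/cvg_ex; exists l; apply/cvgrPdist_le => /= e e0.
have n0 : 0 < (#|I|.+1%:R : R[i]) by [].
have : \forall x \near F, forall i, `|l i - x i| <= e / #|I|.+1%:R.
  apply: filter_forall => i.
  have /cauchy_cvgP : cauchy ((fun x : hsum => x i) @ F) by exact: ci.
  move=> /cvgrPdist_le; apply; exact: divr_gt0.
apply: filterS => x lx; apply: (le_trans (hsum_norm_le _)).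
apply: (@le_trans _ _ (\sum_(i : I) e / #|I|.+1%:R)); first exact: ler_sum.
rewrite sumr_const -[leLHS]mulr_natr mulrAC ler_pdivrMr//.
by apply: ler_wpM2l; [exact: ltW | rewrite ler_nat].
Qed.

HB.instance Definition _ := Uniform_isComplete.Build hsum hsum_complete.

Fact hsum_dot_norm (x : hsum) : hsum_dot x x = `|x| ^+ 2.
Proof. by rewrite -[`|x|]/(hsum_norm x) sqrtCK. Qed.

HB.instance Definition _ :=
  CompleteNormedModule_isHilbert.Build R hsum hsum_dot_norm.

End HilbertSum.

Lemma denseP_norm (C : numFieldType) (V : normedModType C) (S : set V) :
  dense S <-> forall (x : V) (e : C), 0 < e -> exists2 y, S y & `|x - y| < e.
Proof.
split=> [dS x e e0|dS O [x Ox] oO].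
  have [|y [xy Sy]] := dS (ball x e) _ (ball_open x _).
    by exists x; exact: ballxx.
  by exists y => //; move: xy; rewrite -ball_normE.
have /nbhs_ballP[e /= e0 eO] : nbhs x O by exact: open_nbhs_nbhs.
have [y Sy xy] := dS x e e0.
by exists y; split => //; apply: eO; rewrite -ball_normE.
Qed.

Definition tensor_span (R : realType) (K H T : hilbertType R)
    (t : K -> H -> T) : set T :=
  [set x | exists s : seq (K * H), x = \sum_(p <- s) t p.1 p.2].

(** A realization of the Hilbert tensor product K (x) H; it is unique up to a
    unitary operator compatible with [tens]. *)
Record hilbert_tensor (R : realType) (K H : hilbertType R) := HilbertTensor {
  tensor_space : hilbertType R;
  tens : {bilinear K -> H -> tensor_space};
  hdot_tens : forall k h k' h',
    hdot (tens k h) (tens k' h') = hdot k k' * hdot h h';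
  tens_dense : dense (tensor_span tens)
}.

Section HsumInject.
Variables (R : realType) (I : finType) (X : I -> hilbertType R).

Definition hsum_inj (i : I) (x : X i) : hsum X := dfwith (0 : hsum X) x.

Lemma hsum_inj_in i (x : X i) : hsum_inj x i = x.
Proof. exact: dfwith_in. Qed.

Lemma hsum_inj_out i j (x : X i) : i != j -> hsum_inj x j = 0.
Proof. by move=> ij; rewrite /hsum_inj dfwith_out. Qed.

Lemma hsum_addE (x y : hsum X) i : (x + y) i = x i + y i.
Proof. by []. Qed.

Lemma hsum_scaleE (c : R[i]) (x : hsum X) i : (c *: x) i = c *: x i.
Proof. by []. Qed.

Lemma hsum_sumE (J : Type) (s : seq J) (F : J -> hsum X) i :
  (\sum_(j <- s) F j) i = \sum_(j <- s) F j i.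
Proof. by elim/big_rec2: _ => // j y z _ <-. Qed.

Lemma hsum_inj_sum (x : hsum X) : x = \sum_i hsum_inj (x i).
Proof.
apply: functional_extensionality_dep => i; rewrite hsum_sumE (bigD1 i)//=.
by rewrite hsum_inj_in big1 ?addr0// => j; exact: hsum_inj_out.
Qed.

End HsumInject.

Lemma tensor_span_sum (R : realType) (K H T : hilbertType R)
    (t : K -> H -> T) (I : finType) (F : I -> T) :
  (forall i, tensor_span t (F i)) -> tensor_span t (\sum_i F i).
Proof.
move=> Ft; elim/big_ind: _ => [|x y [s ->] [r ->]|i _]; last exact: Ft.
  by exists [::]; rewrite big_nil.
by exists (s ++ r); rewrite big_cat.
Qed.

Section TensorSum.
Variables (R : realType) (I : finType).

Lemma hsum_span_dense (K H : hilbertType R) (T : I -> hilbertType R)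
    (t : K -> H -> hsum T) (S : forall i, set (T i)) :
  (forall i, dense (S i)) ->
  (forall x : hsum T, (forall i, S i (x i)) -> tensor_span t x) ->
  dense (tensor_span t).
Proof.
move=> dS St; apply/denseP_norm => x e e0.
have n0 : 0 < (#|I|.+1%:R : R[i]) by [].
have ex i : exists2 y, S i y & `|x i - y| < e / #|I|.+1%:R.
  have /denseP_norm := dS i.
  by move=> /(_ (x i) _ (divr_gt0 e0 n0))[y]; exists y.
pose y : hsum T := fun i => s2val (cid2 (ex i)).
exists y; first by apply: St => i; rewrite /y; case: cid2.
have xy i : `|x i - y i| < e / #|I|.+1%:R by rewrite /y; case: cid2.
apply: (le_lt_trans (hsum_norm_le (x - y))).
apply: (@le_lt_trans _ _ (\sum_(i : I) e / #|I|.+1%:R)).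
  by apply: ler_sum => i _; apply/ltW/xy.
rewrite sumr_const -[ltLHS]mulr_natr mulrAC ltr_pdivrMr//.
by rewrite ltr_pM2l// ltr_nat.
Qed.

Section SumRight.
Variables (K : hilbertType R) (X : I -> hilbertType R).
Variable T : forall i, hilbert_tensor K (X i).

Definition tens_sumr (k : K) (x : hsum X) : hsum (fun i => tensor_space (T i)) :=
  fun i => tens (T i) k (x i).

Fact tens_sumr_bilinear : bilinear_for *:%R *:%R tens_sumr.
Proof.
by split=> z a x y; apply: functional_extensionality_dep => i;
  rewrite /tens_sumr ?linearPl ?linearPr.
Qed.

HB.instance Definition _ := @bilinear_isBilinear.Build R[i] K (hsum X)
  (hsum (fun i => tensor_space (T i))) *:%R *:%R tens_sumr tens_sumr_bilinear.

Fact hdot_tens_sumr k x k' x' :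
  hdot (tens_sumr k x) (tens_sumr k' x') = hdot k k' * hdot x x'.
Proof.
by rewrite [hdot x x']/(hsum_dot x x') mulr_sumr; apply: eq_bigr => i _; apply: hdot_tens.
Qed.

Fact tens_sumr_dense : dense (tensor_span tens_sumr).
Proof.
apply: (hsum_span_dense (S := fun i => tensor_span (tens (T i)))).
  by move=> i; exact: tens_dense.
move=> x Sx; rewrite (hsum_inj_sum x); apply: tensor_span_sum => i.
have [s ->] := Sx i; exists [seq (p.1, hsum_inj p.2) | p <- s].
rewrite big_map; apply: functional_extensionality_dep => j; rewrite hsum_sumE.
have [<-|ij] := eqVneq i j.
  by rewrite hsum_inj_in; apply: eq_bigr => p _; rewrite /tens_sumr /= hsum_inj_in.
rewrite hsum_inj_out// big1// => p _.
by rewrite /tens_sumr /= hsum_inj_out// linear0r.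
Qed.

Definition tensor_sumr : hilbert_tensor K (hsum X) :=
  HilbertTensor (tens := tens_sumr) hdot_tens_sumr tens_sumr_dense.

End SumRight.

Section SumLeft.
Variables (Y : I -> hilbertType R) (H : hilbertType R).
Variable T : forall i, hilbert_tensor (Y i) H.

Definition tens_suml (k : hsum Y) (h : H) : hsum (fun i => tensor_space (T i)) :=
  fun i => tens (T i) (k i) h.

Fact tens_suml_bilinear : bilinear_for *:%R *:%R tens_suml.
Proof.
by split=> z a x y; apply: functional_extensionality_dep => i;
  rewrite /tens_suml ?linearPl ?linearPr.
Qed.

HB.instance Definition _ := @bilinear_isBilinear.Build R[i] (hsum Y) H
  (hsum (fun i => tensor_space (T i))) *:%R *:%R tens_suml tens_suml_bilinear.

Fact hdot_tens_suml k h k' h' :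
  hdot (tens_suml k h) (tens_suml k' h') = hdot k k' * hdot h h'.
Proof.
by rewrite [hdot k k']/(hsum_dot k k') mulr_suml; apply: eq_bigr => i _; apply: hdot_tens.
Qed.

Fact tens_suml_dense : dense (tensor_span tens_suml).
Proof.
apply: (hsum_span_dense (S := fun i => tensor_span (tens (T i)))).
  by move=> i; exact: tens_dense.
move=> x Sx; rewrite (hsum_inj_sum x); apply: tensor_span_sum => i.
have [s ->] := Sx i; exists [seq (hsum_inj p.1, p.2) | p <- s].
rewrite big_map; apply: functional_extensionality_dep => j; rewrite hsum_sumE.
have [<-|ij] := eqVneq i j.
  by rewrite hsum_inj_in; apply: eq_bigr => p _; rewrite /tens_suml /= hsum_inj_in.
rewrite hsum_inj_out// big1// => p _.
by rewrite /tens_suml /= hsum_inj_out// linear0l.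
Qed.

Definition tensor_suml : hilbert_tensor (hsum Y) H :=
  HilbertTensor (tens := tens_suml) hdot_tens_suml tens_suml_dense.

End SumLeft.
End TensorSum.

Definition finite_dim (R : realType) (H : hilbertType R) : Prop :=
  exists s : seq H, forall x, exists c : nat -> R[i],
    x = \sum_(j < size s) c j *: s`_j.

Definition separable_space (T : topologicalType) : Prop :=
  exists2 D : set T, countable D & dense D.

Section TensorExists.
Variable R : realType.

Lemma gram_schmidt (H : hilbertType R) (s : seq H) :
  exists b : seq H, [/\ uniq b,
    {in b &, forall e f, hdot e f = (e == f)%:R} &
    {in s, forall y, y = \sum_(e <- b) hdot y e *: e}].
Proof.
elim: s => [|y s [b [ub bo bs]]]; first by exists [::].
pose w := y - \sum_(e <- b) hdot y e *: e.
have wb : {in b, forall e, hdot w e = 0}.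
  move=> e eb; rewrite /w linearBl /= linear_sumlz/=.
  rewrite (bigD1_seq e)//= linearZl_LR/= (bo e e)// eqxx mulr1 big_seq_cond big1.
    by rewrite addr0 subrr.
  by move=> f /andP[fb fe]; rewrite linearZl_LR/= (bo f e)// (negPf fe) mulr0.
have [w0|w0] := eqVneq w 0.
  exists b; split=> // z; rewrite inE => /predU1P[->|/bs//].
  by apply/eqP; rewrite -subr_eq0 -/w w0.
have ww : 0 < hdot w w by rewrite dnorm_gt0.
pose e := (sqrtC (hdot w w))^-1 *: w.
have sC : Num.conj (sqrtC (hdot w w))^-1 = (sqrtC (hdot w w))^-1.
  by rewrite conj_Creal// ger0_real// invr_ge0 sqrt_dnorm_ge0.
have eb : {in b, forall f, hdot e f = 0}.
  by move=> f fb; rewrite linearZl_LR/= (wb f)// mulr0.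
have be : {in b, forall f, hdot f e = 0}.
  by move=> f fb; rewrite hermC/= eb// rmorph0 mulr0.
have ee : hdot e e = 1.
  rewrite linearZl_LR/= linearZr_LR/= sC mulrA -expr2 exprVn sqrtCK.
  by rewrite mulVf// gt_eqF.
have e_b : e \notin b.
  by apply/negP => /eb; rewrite ee => /eqP; rewrite oner_eq0.
exists (e :: b); split; first by rewrite /= e_b.
  move=> f g; rewrite !inE => /predU1P[->|fb] /predU1P[->|gb].
  - by rewrite ee eqxx.
  - by rewrite eb//; case: eqP => // eg; rewrite eg gb in e_b.
  - by rewrite be//; case: eqP => // eg; rewrite -eg fb in e_b.
  - exact: bo.
move=> z; rewrite inE big_cons => /predU1P[->|zs].
  rewrite -[LHS](subrK (\sum_(f <- b) hdot y f *: f)) -/w; congr (_ + _).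
  rewrite -[y in RHS](subrK (\sum_(f <- b) hdot y f *: f)) -/w.
  rewrite linearDl/= linear_sumlz/= [X in _ + X]big_seq big1 ?addr0; last first.
    by move=> f fb; rewrite linearZl_LR/= (be f)// mulr0.
  rewrite linearZr_LR/= sC scalerA mulrAC -expr2 exprVn sqrtCK.
  by rewrite mulVf ?scale1r// gt_eqF.
rewrite {2}(bs z zs) linear_sumlz/= big_seq big1 ?scale0r ?add0r; first exact: bs.
by move=> f fb; rewrite linearZl_LR/= (be f)// mulr0.
Qed.

Lemma finite_dim_onb (H : hilbertType R) : finite_dim H ->
  exists n (e : 'I_n -> H), (forall i j, hdot (e i) (e j) = (i == j)%:R) /\
    forall x, x = \sum_i hdot x (e i) *: e i.
Proof.
move=> [s sH]; have [b [ub bo bs]] := gram_schmidt s.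
exists (size b), (fun i => b`_i); split=> [i j|x].
  by rewrite bo ?mem_nth// nth_uniq.
transitivity (\sum_(e <- b) hdot x e *: e); last first.
  by rewrite (big_nth 0) big_mkord.
have [c ->] := sH x.
under [RHS]eq_bigr do rewrite linear_sumlz/= scaler_suml.
rewrite exchange_big/=; apply: eq_bigr => j _.
rewrite [in LHS](bs s`_j) ?mem_nth// scaler_sumr; apply: eq_bigr => f _.
by rewrite linearZl_LR; apply: scalerA.
Qed.

Section Coordinates.
Variables (K H : hilbertType R) (n : nat) (e : 'I_n -> H).
Hypothesis eo : forall i j, hdot (e i) (e j) = (i == j)%:R.
Hypothesis eH : forall x, x = \sum_i hdot x (e i) *: e i.

Let T : hilbertType R := hsum (fun _ : 'I_n => K).
Let t (k : K) (h : H) : T := fun i => hdot h (e i) *: k.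

Let t_bilinear : bilinear_for *:%R *:%R t.
Proof.
split=> z a x y; apply: functional_extensionality_dep => i; rewrite /t.
  change (hdot z (e i) *: (a *: x + y) =
    a *: (hdot z (e i) *: x) + hdot z (e i) *: y).
  by rewrite scalerDr !scalerA [a * _]mulrC.
change (hdot (a *: x + y) (e i) *: z =
  a *: (hdot x (e i) *: z) + hdot y (e i) *: z).
by rewrite linearDl/= linearZl_LR/= scalerDl scalerA.
Qed.

HB.instance Definition _ := @bilinear_isBilinear.Build R[i] K H T *:%R *:%R
  t t_bilinear.

Let hdot_t k h k' h' : hdot (t k h) (t k' h') = hdot k k' * hdot h h'.
Proof.
rewrite [LHS]/(hsum_dot _ _) /hsum_dot [in hdot h h'](eH h) linear_sumlz mulr_sumr.
apply: eq_bigr => i _ /=; rewrite /t !linearZl_LR/= linearZr_LR/=.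
by rewrite [hdot (e i) h']hermC/= expr0 mul1r; ring.
Qed.

Let t_dense : dense (tensor_span t).
Proof.
move=> O [x Ox] _; exists x; split => //.
exists [seq (x i, e i) | i <- enum 'I_n].
rewrite big_map big_enum/=; apply: functional_extensionality_dep => i.
rewrite hsum_sumE (bigD1 i)//= /t eo eqxx scale1r big1 ?addr0// => j ji.
by rewrite eo (negPf ji) scale0r.
Qed.

Definition coord_tensor : hilbert_tensor K H :=
  HilbertTensor (tens := t) hdot_t t_dense.

End Coordinates.

Lemma hilbert_tensor_exists (K H : hilbertType R) :
  finite_dim H -> inhabited (hilbert_tensor K H).
Proof.
move=> /finite_dim_onb[n [e [eo eH]]]; exact: (inhabits (coord_tensor K eo eH)).
Qed.

End TensorExists.

Section Operators.
Variable R : realType.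
Implicit Types X Y : hilbertType R.

(** [bounded_op X Y] is the space L(X, Y). *)
Definition bounded_op X Y : set (X -> Y) :=
  [set A | linear A /\ exists c : R[i], forall x, `|A x| <= c * `|x|].

(** The norm of a vector is an element of [R[i]], hence the real part. *)
Definition opnorm X Y (A : X -> Y) : R :=
  sup [set complex.Re `|A x| | x in [set x | `|x| <= 1]].

(** [A] is invertible in L(X, Y), with inverse [B]. *)
Definition inverse_op X Y (A : X -> Y) (B : Y -> X) : Prop :=
  [/\ bounded_op A, bounded_op B, cancel A B & cancel B A].

Definition spectrum X (A : X -> X) : set R[i] :=
  [set l | ~ exists B, inverse_op (fun x => l *: x - A x) B].

(** The adjoint of a bounded operator, picked by its defining property. *)
Definition adjoint X Y (A : X -> Y) : Y -> X :=
  xget (fun=> 0)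
    [set B | bounded_op B /\ forall x y, hdot (A x) y = hdot x (B y)].

(** On a complex Hilbert space, the condition forces [A] to be self-adjoint,
    since [0 < z] in [R[i]] entails that [z] is real. *)
Definition posdef_op X (A : X -> X) : Prop :=
  bounded_op A /\ forall x, x != 0 -> 0 < hdot (A x) x.

Definition negdef_op X (A : X -> X) : Prop :=
  bounded_op A /\ forall x, x != 0 -> hdot (A x) x < 0.

Definition hsum_op (I : finType) (X Y : I -> hilbertType R)
    (A : forall i, X i -> Y i) : hsum X -> hsum Y :=
  fun x i => A i (x i).

(** The operator A (x) B, picked as the unique bounded operator mapping
    k (x) h to A k (x) B h. *)
Definition tensor_op (K H K' H' : hilbertType R)
    (T : hilbert_tensor K H) (T' : hilbert_tensor K' H')
    (A : K -> K') (B : H -> H') : tensor_space T -> tensor_space T' :=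
  xget (fun=> 0) [set D : tensor_space T -> tensor_space T' | bounded_op D /\
    forall k h, D (tens T k h) = tens T' (A k) (B h)].

End Operators.
Arguments tensor_op {R K H K' H'} T T' A B _.

Section StructuredSingularValue.
Variables (R : realType) (XR XS : hilbertType R).
Variables (Delta : set (XR -> XS)) (M : XS -> XR).

Definition singular_radii : set R :=
  [set opnorm D | D in [set D | Delta D /\ spectrum (M \o D) 1]].

(** For bounded [M], the infimum is positive when the set is nonempty:
    1 can only be in the spectrum of [M \o D] if [1 <= opnorm M * opnorm D]. *)
Definition mu : R :=
  if `[< singular_radii = set0 >] then 0 else (inf singular_radii)^-1.

Definition commutant : set ((XR -> XR) * (XS -> XS)) :=
  [set XY | [/\ bounded_op XY.1, bounded_op XY.2 &
    forall D, Delta D -> D \o XY.1 = XY.2 \o D]].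

Definition mu_hat : R :=
  inf [set r | exists (X X' : XR -> XR) (Y Y' : XS -> XS),
    [/\ commutant (X, Y), inverse_op X X',
    inverse_op Y Y' & r = opnorm (X \o M \o Y')]].

End StructuredSingularValue.

(** By [edge_bipartite] the graph has no loops; as [edge] is a relation, it has
    no multiple edges either. *)
Record bipartite_graph := BipartiteGraph {
  vertex : finType;
  source_vertex : {set vertex};
  edge : rel vertex;
  edge_sym : symmetric edge;
  edge_bipartite : forall u v, edge u v -> (u \in source_vertex) != (v \in source_vertex)
}.

Section Graph.
Variable G : bipartite_graph.

Definition range_vertex : {set vertex G} := ~: source_vertex G.

Definition components : {set {set vertex G}} :=
  equivalence_partition (connect (@edge G)) [set: vertex G].

Definition component : Type := {p : {set vertex G} | p \in components}.
HB.instance Definition _ := Finite.on component.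

Definition comp_source (p : component) : finType :=
  {v : vertex G | (v \in source_vertex G) && (v \in val p)}.

Definition comp_range (p : component) : finType :=
  {v : vertex G | (v \in range_vertex) && (v \in val p)}.

Definition complete_bipartite_components : Prop := forall p : component,
  [/\ exists s : vertex G, (s \in source_vertex G) && (s \in val p),
      exists r : vertex G, (r \in range_vertex) && (r \in val p) &
      forall (s : comp_source p) (r : comp_range p), edge (val s) (val r)].

End Graph.

Section Structures.
Variables (R : realType) (G : bipartite_graph).
Variable H : component G -> hilbertType R.

(** C^n (x) H_p is realized as the direct sum of n copies of H_p. *)
Definition HSp p : hilbertType R := hsum (fun _ : comp_source p => H p).
Definition HRp p : hilbertType R := hsum (fun _ : comp_range p => H p).
Definition HS : hilbertType R := hsum HSp.
Definition HR : hilbertType R := hsum HRp.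

(** W (x) I for an operator W from C^(R_p) to C^(S_p), given by its matrix. *)
Definition matrix_tensor_id p (W : comp_source p -> comp_range p -> R[i]) :
  HRp p -> HSp p := fun x s => \sum_r W s r *: x r.

Definition Delta_G : set (HR -> HS) :=
  [set D | exists W : forall p, comp_source p -> comp_range p -> R[i],
    D = hsum_op (fun p => matrix_tensor_id (W p))].

Definition gamma_source (Gamma : forall p, H p -> H p) : HS -> HS :=
  hsum_op (fun p => hsum_op (fun _ : comp_source p => Gamma p)).
Definition gamma_range (Gamma : forall p, H p -> H p) : HR -> HR :=
  hsum_op (fun p => hsum_op (fun _ : comp_range p => Gamma p)).

Section Enhanced.
Variables (K : hilbertType R) (T : forall p, hilbert_tensor K (H p)).

Definition tensor_HSp p : hilbert_tensor K (HSp p) :=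
  tensor_sumr (fun _ : comp_source p => T p).
Definition tensor_HRp p : hilbert_tensor K (HRp p) :=
  tensor_sumr (fun _ : comp_range p => T p).
Definition tensor_HS : hilbert_tensor K HS := tensor_sumr tensor_HSp.
Definition tensor_HR : hilbert_tensor K HR := tensor_sumr tensor_HRp.

Definition KHS : hilbertType R := tensor_space tensor_HS.
Definition KHR : hilbertType R := tensor_space tensor_HR.

(** K (x) C^n is realized as the direct sum of n copies of K. *)
Definition KSp (p : component G) : hilbertType R := hsum (fun _ : comp_source p => K).
Definition KRp (p : component G) : hilbertType R := hsum (fun _ : comp_range p => K).

(** The direct sum of copies of K (x) H_p is used as a tensor product in two
    ways: as K (x) (C^n (x) H_p) by [tensor_HRp], [tensor_HSp], and here as
    (K (x) C^n) (x) H_p by [tensor_suml]. *)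
Definition op_tensor_id p (W : KRp p -> KSp p) :
    tensor_space (tensor_HRp p) -> tensor_space (tensor_HSp p) :=
  tensor_op
    (tensor_suml (fun _ : comp_range p => T p))
    (tensor_suml (fun _ : comp_source p => T p)) W idfun.

Definition Delta_Gbar : set (KHR -> KHS) :=
  [set D | exists2 W : forall p, KRp p -> KSp p,
    forall p, bounded_op (W p) & D = hsum_op (fun p => op_tensor_id (W p))].

Definition mu_tilde (M : HS -> HR) : R :=
  mu Delta_Gbar (tensor_op tensor_HS tensor_HR idfun M).

End Enhanced.
End Structures.

(* Main.v *)
(** The bound [mu <= mu_hat] is the scaling argument: a commuting pair [(X, Y)]
    gives [(I (x) Y) D = D (I (x) X)] for every [D] in the enhanced structure, so
    that [I - (I (x) M) D] is similar to [I - (I (x) X M Y^-1) D], which is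
    invertible when [|X M Y^-1| |D| < 1].

    For the converse, let [t > 0]. By convex duality in finite dimension, either
    the inequality [M^* Gamma M < t^2 Gamma] has a positive definite solution, or
    some nonzero positive semidefinite [Q = sum_j x_j x_j^*] has the partial traces
    of [M Q M^*] dominating those of [t^2 Q]. In the first case a factorization
    [Gamma = L^* L] yields a scaling with [|L M L^-1| < t]. In the second case take
    orthonormal vectors [kappa_j] of [K], which exist because [K] is
    infinite-dimensional, and put [x = sum_j kappa_j (x) x_j]: Douglas' lemma,
    applied on each component, gives [D] in the enhanced structure with
    [|D| <= 1/t] and [D (I (x) M) x = x], hence [mu >= t]. *)
From HB Require Import structures.
Require Import Defs.
From mathcomp Require Import all_boot all_order all_algebra ring lra.
From mathcomp Require Import sesquilinear complex.
From mathcomp Require Import boolp classical_sets functions cardinality reals.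
From mathcomp Require Import topology normedtype sequences derive.

Set Implicit Arguments.
Unset Strict Implicit.
Unset Printing Implicit Defensive.
Import Order.TTheory GRing.Theory Num.Theory.
Import numFieldNormedType.Exports.
Local Open Scope ring_scope.
Local Open Scope complex_scope.
Local Open Scope classical_set_scope.

(** * Orthonormal families *)

(** Two difficulties shape the proof. The duality needs a nonzero witness on one side and strict
    positivity on the other. For this a positive semidefinite [Q] is represented by a finite family
    of vectors, and the partial trace conditions become finitely many equations between sesquilinear
    forms, a slack vector on each component turning domination into equality. Tested alone, the same
    slack makes each [Gamma p] positive definite. The multipliers are found by minimizing a sum of
    squares over a compact sphere, and the length of the family depends on the dimension of the
    forms, so [K] must contain orthonormal families of every finite length.

    The two bounds must also meet exactly. In finite dimension a solution of the inequality at level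
    [t] leaves a uniform gap, so it gives [mu_hat < t] and not only [mu_hat <= t]; the duality can
    then be applied at [t = mu_hat] itself.

    Finite dimension of the [H p] makes every vector of the tensor product of [K] with [H p] a
    finite sum of [k_i (x) e_i], so operators are computed on coordinates in [K]. *)

Section GramSchmidtForm.
Variables (C : numClosedFieldType) (U : lmodType C).
Variable form : {dot U for Num.conj : C -> C}.

Local Notation "''[' u , v ]" := (form u v).

Definition orthonormal_fam (I : finType) (e : I -> U) :=
  forall i j, '[e i, e j] = (i == j)%:R.

(** Subspaces as predicates: they record that Gram-Schmidt does not leave the span of its input. *)
Definition lin_closed (P : U -> Prop) :=
  P 0 /\ forall a x y, P x -> P y -> P (a *: x + y).

Lemma lin_closed_sum (P : U -> Prop) (I : eqType) (s : seq I) (c : I -> C) (x : I -> U) :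
  lin_closed P -> {in s, forall i, P (x i)} -> P (\sum_(i <- s) c i *: x i).
Proof.
move=> [P0 PD]; elim: s => [|i s IH] Ps; first by rewrite big_nil.
rewrite big_cons; apply: PD; first by apply: Ps; rewrite mem_head.
by apply: IH => j js; apply: Ps; rewrite inE js orbT.
Qed.

Lemma dot_conj u v : '[u, v] = Num.conj '[v, u].
Proof. by rewrite hermC/= expr0 mul1r. Qed.

(** One Gram-Schmidt step: the normalized residual of [y] becomes the vector of index 0 and the old
    ones are shifted by one. *)
Lemma orthonormal_extend n (b : 'I_n -> U) y : orthonormal_fam b ->
  y != \sum_i '[y, b i] *: b i ->
  exists b' : 'I_n.+1 -> U, [/\ orthonormal_fam b',
    forall x, x = \sum_i '[x, b i] *: b i -> x = \sum_i '[x, b' i] *: b' i,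
    y = \sum_i '[y, b' i] *: b' i &
    forall P, lin_closed P -> P y -> (forall i, P (b i)) -> forall i, P (b' i)].
Proof.
move=> bo; rewrite -subr_eq0; set w := y - _ => w0.
have wb i : '[w, b i] = 0.
  rewrite /w linearBl /= linear_sumlz/= (bigD1 i)//= linearZl_LR/= bo eqxx mulr1.
  rewrite big1 ?addr0 ?subrr// => j ji.
  by rewrite linearZl_LR/= bo (negPf ji) mulr0.
have ww : 0 < '[w, w] by rewrite dnorm_gt0.
set r := sqrtC '[w, w].
have r0 : r != 0 by rewrite sqrtC_eq0 gt_eqF.
have rC : Num.conj r = r by rewrite conj_Creal// ger0_real// sqrt_dnorm_ge0.
have rr : '[w, w] = r * r by rewrite -expr2 sqrtCK.
pose e := r^-1 *: w.
have eb i : '[e, b i] = 0 by rewrite linearZl_LR/= wb mulr0.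
have be i : '[b i, e] = 0 by rewrite dot_conj eb rmorph0.
have ee : '[e, e] = 1.
  rewrite linearZl_LR/= linearZr_LR/= fmorphV/= rC rr; field.
  exact: r0.
pose b' (i : 'I_n.+1) := if unlift ord0 i is Some j then b j else e.
have b'0 : b' ord0 = e by rewrite /b' unlift_none.
have b'S i : b' (lift ord0 i) = b i by rewrite /b' liftK.
have b'o : orthonormal_fam b'.
  move=> i j; case: (unliftP ord0 i) => [i' ->|->]; case: (unliftP ord0 j) => [j' ->|->].
  - by rewrite !b'S bo (inj_eq lift_inj).
  - by rewrite b'0 b'S be eq_sym (negPf (neq_lift _ _)).
  - by rewrite b'0 b'S eb (negPf (neq_lift _ _)).
  - by rewrite !b'0 ee eqxx.
exists b'; split=> //.
- move=> x xb; rewrite big_ord_recl b'0.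
  have -> : '[x, e] = 0.
    by rewrite xb linear_sumlz big1//= => i _; rewrite linearZl_LR/= be mulr0.
  by rewrite scale0r add0r {1}xb; apply: eq_bigr => i _; rewrite b'S.
- rewrite big_ord_recl b'0.
  have -> : '[y, e] = r.
    rewrite -[y](subrK (\sum_i '[y, b i] *: b i)) -/w linearDl/= linear_sumlz/=.
    rewrite big1 ?addr0 => [|i _]; last by rewrite linearZl_LR/= be mulr0.
    by rewrite linearZr_LR/= fmorphV/= rC rr; field.
  rewrite /e scalerA mulfV// scale1r.
  under eq_bigr do rewrite b'S.
  by rewrite subrK.
- move=> P Pc Py Pb i; case: (unliftP ord0 i) => [i' ->|->]; rewrite ?b'0 ?b'S//.
  have [P0 PD] := Pc.
  have Ps : P (\sum_i '[y, b i] *: b i) by apply: lin_closed_sum.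
  have Pw : P w by rewrite /w addrC -scaleN1r; apply: PD.
  by rewrite /e -[X in P X]addr0; apply: PD.
Qed.

(** Dependent vectors are skipped. The clause on [P] keeps the basis inside the span of [v], which
    [douglas] uses to express it through its data. *)
Lemma orthonormal_span (I : finType) (v : I -> U) :
  exists n (b : 'I_n -> U), [/\ orthonormal_fam b,
    forall i, v i = \sum_j '[v i, b j] *: b j &
    forall P, lin_closed P -> (forall i, P (v i)) -> forall j, P (b j)].
Proof.
suff [n [b [bo bs bP]]] : exists n (b : 'I_n -> U), [/\ orthonormal_fam b,
    {in enum I, forall i, v i = \sum_j '[v i, b j] *: b j} &
    forall P, lin_closed P -> (forall i, P (v i)) -> forall j, P (b j)].
  by exists n, b; split=> // i; apply: bs; rewrite mem_enum.
elim: (enum I) => [|i s [n [b [bo bs bP]]]].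
  have f : 'I_0 -> U by case.
  by exists 0%N, f; split=> // [[]|P _ _ []].
have [vi|vi] := eqVneq (v i) (\sum_j '[v i, b j] *: b j).
  by exists n, b; split=> // j; rewrite inE => /predU1P[->|/bs].
have [b' [b'o b's b'i b'P]] := orthonormal_extend bo vi.
exists n.+1, b'; split=> // [j|P Pc Pv].
  by rewrite inE => /predU1P[->//|/bs/b's].
by apply: b'P => //; exact: bP.
Qed.

Lemma orthonormal_coord (I : finType) (e : I -> U) (c : I -> C) i :
  orthonormal_fam e -> '[\sum_j c j *: e j, e i] = c i.
Proof.
move=> eo; rewrite linear_sumlz/= (bigD1 i)//= linearZl_LR/= eo eqxx mulr1.
by rewrite big1 ?addr0// => j ji; rewrite linearZl_LR/= eo (negPf ji) mulr0.
Qed.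

Lemma orthonormal_dot (I : finType) (e : I -> U) (c d : I -> C) :
  orthonormal_fam e ->
  '[\sum_j c j *: e j, \sum_j d j *: e j] = \sum_j c j * Num.conj (d j).
Proof.
move=> eo; rewrite linear_sumr/=; apply: eq_bigr => j _.
by rewrite linearZr_LR/= orthonormal_coord// mulrC.
Qed.

End GramSchmidtForm.

(** * Bounded operators *)

Section LinearMaps.
Variables (R : realType) (X Y : lmodType R[i]) (A : X -> Y).
Hypothesis lA : linear A.

Lemma linear_fun0 : A 0 = 0.
Proof.
have := lA (-1) 0 0.
by rewrite scaler0 addr0 scaleN1r => /eqP; rewrite addrC -subr_eq0 opprB addrA addrK => /eqP.
Qed.

Lemma linear_funZ a x : A (a *: x) = a *: A x.
Proof. by have := lA a x 0; rewrite linear_fun0 !addr0. Qed.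

Lemma linear_funD x y : A (x + y) = A x + A y.
Proof. by have := lA 1 x y; rewrite !scale1r. Qed.

Lemma linear_funB x y : A (x - y) = A x - A y.
Proof. by rewrite linear_funD -scaleN1r linear_funZ scaleN1r. Qed.

Lemma linear_fun_sum (I : Type) (s : seq I) (P : pred I) (F : I -> X) :
  A (\sum_(i <- s | P i) F i) = \sum_(i <- s | P i) A (F i).
Proof. exact: (big_morph A linear_funD linear_fun0). Qed.

Lemma linear_fun_comb (I : Type) (s : seq I) (c : I -> R[i]) (F : I -> X) :
  A (\sum_(i <- s) c i *: F i) = \sum_(i <- s) c i *: A (F i).
Proof. by rewrite linear_fun_sum; apply: eq_bigr => i _; rewrite linear_funZ. Qed.

End LinearMaps.

Section DenseRange.
Variables (R : realType) (X Y : hilbertType R) (J : X -> Y) (d c : R[i]).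
Hypotheses (lJ : linear J) (d0 : 0 < d) (c0 : 0 < c).
Hypothesis lowJ : forall x, d * `|x| <= `|J x|.
Hypothesis upJ : forall x, `|J x| <= c * `|x|.
Hypothesis denseJ : forall y e, 0 < e -> exists x, `|y - J x| < e.

(** The approximate preimages of [y] form a Cauchy filter by the lower bound; completeness of [X]
    provides a limit, and the upper bound shows that it is mapped to [y]. *)
Lemma bounded_below_dense_surj y : exists x, J x = y.
Proof.
pose F := filter_from [set e : R[i] | 0 < e] (fun e => [set x | `|y - J x| < e]).
have FF : ProperFilter F.
  apply: filter_from_proper; last by move=> e e0; have [x] := denseJ y e0; exists x.
  apply: filter_from_filter; first by exists 1 => /=.
  move=> e1 e2 /= e10 e20; have [le12|le21] := real_leP (gtr0_real e10) (gtr0_real e20).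
    by exists e1 => // x /= xe; split=> //; exact: lt_le_trans xe le12.
  by exists e2 => // x /= xe; split=> //; exact: lt_trans xe le21.
have cF : cauchy F.
  apply: cauchy_exP => e /= e0.
  (* Two points whose images are within [d * e / 2] of [y] have images within [d * e] of each other,
     hence are within [e]. *)
  have de0 : 0 < d * e / 2 by rewrite divr_gt0// mulr_gt0.
  have [x0 x0y] := denseJ y de0; exists x0; exists (d * e / 2) => //= x xy.
  rewrite -ball_normE/= -(@ltr_pM2l _ d)//.
  apply: (le_lt_trans (lowJ _)); rewrite linear_funB//.
  have -> : J x0 - J x = (y - J x) - (y - J x0) by rewrite opprB [RHS]addrC addrA subrK.
  apply: (le_lt_trans (ler_normB _ _)).
  by rewrite [ltRHS](splitr (d * e)) ltrD.
have /cvg_ex[l Fl] : cvg F by exact: cauchy_cvg.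
exists l; apply/eqP; rewrite eq_sym -subr_eq0 -normr_eq0; apply/negPn/negP => n0.
have {}n0 : 0 < `|y - J l| by rewrite normr_gt0 -normr_eq0.
set e := `|y - J l| in n0 *.
have e2 : 0 < e / 2 by rewrite divr_gt0.
have ec : 0 < e / 2 / c by rewrite divr_gt0.
have Fy : F [set x | `|y - J x| < e / 2] by exists (e / 2).
have /fcvgrPdist_lt/(_ _ ec) Fle := Fl.
have [x [/= xy xl]] := filter_ex (filterI Fy Fle).
suff : e < e by rewrite ltxx.
rewrite {1}/e -(subrKA (J x)) (le_lt_trans (ler_normD _ _))//.
rewrite [ltRHS](splitr e) ltrD// -linear_funB// (le_lt_trans (upJ _))//.
by rewrite mulrC -ltr_pdivlMr// distrC.
Qed.

End DenseRange.

Section OperatorNorm.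
Variables (R : realType).
Implicit Types X Y Z : hilbertType R.

Lemma normE X (x : X) : `|x| = (complex.Re `|x|)%:C.
Proof. by rewrite RRe_real// ger0_real. Qed.

Lemma ltr0c (k : R) : (0 < k%:C) = (0 < k).
Proof. by simpc. Qed.

Lemma linear_bounded_op X Y (A : X -> Y) (c : R) : linear A ->
  (forall x, `|A x| <= c%:C * `|x|) -> bounded_op A.
Proof. by move=> lA cA; split=> //; exists c%:C. Qed.

Lemma bounded_opP X Y (A : X -> Y) : bounded_op A ->
  exists2 c : R, 0 < c & forall x, `|A x| <= c%:C * `|x|.
Proof.
(* The order of [R[i]] compares real parts, so the real part of the complex constant is enough;
   [+ 1] makes it positive. *)
move=> [_ [c cA]]; exists (`|complex.Re c| + 1); first by rewrite ltr_pwDr.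
move=> x; have := cA x; rewrite (normE x) (normE (A x)).
case: c {cA} => a b; simpc => /andP[_ le]; simpc; apply: (le_trans le).
have x0 : 0 <= complex.Re `|x| by rewrite -ler0c -normE.
have := ler_norm a; nra.
Qed.

Let unit_norms X Y (A : X -> Y) : set R :=
  [set complex.Re `|A x| | x in [set x | `|x| <= 1]].

Let has_sup_unit_norms X Y (A : X -> Y) : bounded_op A -> has_sup (unit_norms A).
Proof.
move=> bA; have [lA _] := bA; have [c c0 cA] := bounded_opP bA; split.
  by exists (complex.Re `|A 0|); exists 0 => //=; rewrite normr0.
exists c => _ [x /= x1 <-]; rewrite -lecR -normE; apply: (le_trans (cA x)).
by rewrite ler_piMr// ler0c ltW.
Qed.

Lemma opnorm_ge0 X Y (A : X -> Y) : bounded_op A -> 0 <= opnorm A.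
Proof.
move=> bA; have [lA _] := bA; apply: sup_upper_bound; first exact: has_sup_unit_norms.
exists 0 => /=; first by rewrite normr0.
by rewrite linear_fun0// normr0.
Qed.

Lemma opnormP X Y (A : X -> Y) x : bounded_op A -> `|A x| <= (opnorm A)%:C * `|x|.
Proof.
move=> bA; have [lA _] := bA.
have [->|x0] := eqVneq x 0; first by rewrite linear_fun0// !normr0 mulr0.
have nx : 0 < `|x| by rewrite normr_gt0.
rewrite -ler_pdivrMr//.
have -> : `|A x| / `|x| = `|A (`|x|^-1 *: x)|.
  by rewrite linear_funZ// normrZ ger0_norm ?invr_ge0// mulrC.
rewrite normE lecR; apply: sup_upper_bound; first exact: has_sup_unit_norms.
exists (`|x|^-1 *: x) => //=.
by rewrite normrZ ger0_norm ?invr_ge0// mulVf// gt_eqF.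
Qed.

Lemma opnorm_le X Y (A : X -> Y) (c : R) : linear A -> 0 <= c ->
  (forall x, `|A x| <= c%:C * `|x|) -> opnorm A <= c.
Proof.
move=> lA c0 cA; apply: ge_sup; first by exists (complex.Re `|A 0|), 0; rewrite //= normr0.
move=> _ [x /= x1 <-]; rewrite -lecR -normE; apply: (le_trans (cA x)).
by rewrite ler_piMr// ler0c.
Qed.

Lemma bounded_comp X Y Z (A : X -> Y) (B : Y -> Z) :
  bounded_op A -> bounded_op B -> bounded_op (B \o A).
Proof.
move=> bA bB; have [lA _] := bA; have [lB _] := bB.
have [a a0 aA] := bounded_opP bA; have [b b0 bB'] := bounded_opP bB.
apply: (@linear_bounded_op _ _ _ (b * a)).
  by move=> k x y /=; rewrite lA lB.
move=> x /=; apply: (le_trans (bB' _)); rewrite rmorphM/= -mulrA.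
by rewrite ler_wpM2l// ler0c ltW.
Qed.

Lemma inverse_linear X Y (A : X -> Y) (B : Y -> X) : linear A -> cancel A B ->
  cancel B A -> linear B.
Proof. by move=> lA AB BA k x y; rewrite -{1}(BA x) -{1}(BA y) -lA AB. Qed.

Lemma inverse_op_comp X Y Z (A : X -> Y) A' (B : Y -> Z) B' :
  inverse_op A A' -> inverse_op B B' -> inverse_op (B \o A) (A' \o B').
Proof.
move=> [bA bA' AK A'K] [bB bB' BK B'K]; split; try exact: bounded_comp.
  by move=> x /=; rewrite BK AK.
by move=> x /=; rewrite A'K B'K.
Qed.

Lemma inverse_op_sym X Y (A : X -> Y) A' : inverse_op A A' -> inverse_op A' A.
Proof. by case. Qed.

(** The lower bound [1 - c] for [J] gives injectivity and a bounded inverse. Partial sums [s n] of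
    the Neumann series only have to show dense range: [J (s n)] misses [y] by the [n]-th iterate of
    [A] on [y]. *)
Lemma contraction_resolvent X (A : X -> X) (c : R) : linear A -> 0 <= c -> c < 1 ->
  (forall x, `|A x| <= c%:C * `|x|) -> exists B, inverse_op (fun x => x - A x) B.
Proof.
move=> lA c0 c1 cA; set J := fun x => x - A x.
have lJ : linear J.
  by move=> a x y; rewrite /J lA scalerBr opprD addrACA.
have low x : (1 - c)%:C * `|x| <= `|J x|.
  rewrite rmorphB/= mulrBl mul1r lerBlDr -{1}(subrK (A x) x).
  by rewrite (le_trans (ler_normD _ _))// lerD2l.
have up x : `|J x| <= (1 + c)%:C * `|x|.
  by rewrite rmorphD/= mulrDl mul1r (le_trans (ler_normB _ _))// lerD2l.
have d0 : 0 < (1 - c)%:C by rewrite ltr0c subr_gt0.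
have e0 : 0 < (1 + c)%:C by rewrite ltr0c ltr_pwDl.
have surj : forall y, exists x, J x = y.
  apply: (bounded_below_dense_surj lJ d0 e0 low up) => y e ep.
  pose s n := \sum_(i < n) iter i A y.
  have sE n : y - J (s n) = iter n A y.
    elim: n => [|n IH]; first by rewrite /s big_ord0 (linear_fun0 lJ) subr0.
    by rewrite /s big_ord_recr/= (linear_funD lJ) opprD addrA IH /J opprB addrC subrK.
  have itn n : `|iter n A y| <= (c ^+ n)%:C * `|y|.
    elim: n => [|n IH]; first by rewrite expr0 mul1r.
    rewrite iterS (le_trans (cA _))// exprS rmorphM/= -mulrA ler_wpM2l// ler0c//.
  have e1 : 0 < complex.Re e / (complex.Re `|y| + 1).
    rewrite divr_gt0//; first by move: ep; rewrite ltcE/= => /andP[].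
    by rewrite ltr_pwDr// -ler0c -normE.
  have c1' : `|c| < 1 by rewrite ger0_norm.
  have /cvgrPdist_lt/(_ _ e1)/filter_ex[n] := cvg_expr c1'.
  rewrite sub0r normrN ger0_norm ?exprn_ge0// => cn.
  exists (s n); rewrite sE; apply: (le_lt_trans (itn n)).
  rewrite (normE y) -rmorphM/= -(RRe_real (gtr0_real ep)) ltcR.
  have y0 : 0 <= complex.Re `|y| by rewrite -ler0c -normE.
  move: cn; rewrite ltr_pdivlMr ?ltr_wpDl// mulrDr mulr1.
  by apply: le_lt_trans; rewrite lerDl exprn_ge0.
pose B y := projT1 (cid (surj y)).
have BK : cancel B J by move=> y; rewrite /B; case: cid.
have KB : cancel J B.
  move=> x; apply/eqP; rewrite -subr_eq0 -normr_eq0; apply/eqP/le_anti.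
  by rewrite normr_ge0 andbT -(pmulr_rle0 _ d0) (le_trans (low _))//
    (linear_funB lJ) BK subrr normr0.
exists B; split=> //; first exact: (linear_bounded_op lJ up).
apply: (@linear_bounded_op _ _ _ (1 - c)^-1); first exact: inverse_linear KB BK.
move=> y; rewrite fmorphV/= mulrC ler_pdivlMr// mulrC.
by rewrite -{2}(BK y); exact: low.
Qed.

End OperatorNorm.

(** * Finite-dimensional Hilbert spaces *)

Section FiniteDimension.
Variable R : realType.
Implicit Types H X Y : hilbertType R.

Lemma hdot_conj X (x y : X) : hdot x y = Num.conj (hdot y x).
Proof. exact: dot_conj. Qed.

Lemma hdot0l X (x : X) : hdot 0 x = 0.
Proof. by rewrite linear0l. Qed.

Lemma hdot_le X (x y : X) : `|hdot x y| <= `|x| * `|y|.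
Proof.
rewrite -(@ler_pXn2r _ 2)// ?nnegrE ?mulr_ge0// exprMn -!hdot_norm.
exact: dot_CauchySchwarz.
Qed.

Lemma norm_sum_orthonormal H (I : finType) (e : I -> H) (c : I -> R[i]) :
  orthonormal_fam hdot e -> `|\sum_i c i *: e i| ^+ 2 = \sum_i `|c i| ^+ 2.
Proof.
by move=> eo; rewrite -hdot_norm orthonormal_dot//; apply: eq_bigr => i _; rewrite normCK.
Qed.

Lemma bessel H (I : finType) (e : I -> H) x : orthonormal_fam hdot e ->
  `|\sum_i hdot x (e i) *: e i| <= `|x|.
Proof.
move=> eo; set p := \sum_i _.
rewrite -(@ler_pXn2r _ 2)// ?nnegrE// -!hdot_norm -{1 2}(subrK p x).
rewrite hnormDd ?lerDr ?dnorm_ge0//=.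
rewrite {2}/p linear_sumr/= big1// => i _.
by rewrite linearZr_LR/= linearBl/= /p orthonormal_coord// subrr mulr0.
Qed.

Definition is_onb H (I : finType) (e : I -> H) :=
  orthonormal_fam hdot e /\ forall x, x = \sum_i hdot x (e i) *: e i.

Lemma finite_dim_fam H (I : finType) (b : I -> H) :
  (forall x, exists c : I -> R[i], x = \sum_i c i *: b i) -> finite_dim H.
Proof.
move=> bH; exists (codom b) => x; have [c ->] := bH x.
exists (fun j => if insub j is Some k then c (enum_val (A := I) (k : 'I_#|I|)) else 0).
rewrite size_codom (reindex (@enum_val I I)) /=; last first.
  by exists enum_rank => i _; rewrite ?enum_valK ?enum_rankK.
apply: eq_bigr => k _; rewrite valK.
by rewrite (nth_map (enum_default k)) -?cardE// /enum_val.
Qed.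

Lemma finite_dim_hsum (I : finType) (X : I -> hilbertType R) :
  (forall i, finite_dim (X i)) -> finite_dim (hsum X).
Proof.
move=> /(_ _)/finite_dim_onb fX.
have [n nP] := boolp.choice fX.
pose e i : 'I_(n i) -> X i := projT1 (cid (nP i)).
have eP i : forall x, x = \sum_j hdot x (e i j) *: e i j.
  by have [] := projT2 (cid (nP i)).
apply: (@finite_dim_fam _ {i : I & 'I_(n i)} (fun u => hsum_inj (e (tag u) (tagged u)))).
move=> x; exists (fun u => hdot (x (tag u)) (e (tag u) (tagged u))).
rewrite -(sig_big_dep (fun _ => true) (fun _ _ => true)
  (fun i j => hdot (x i) (e i j) *: hsum_inj (e i j))) /=.
rewrite [LHS]hsum_inj_sum; apply: eq_bigr => i _.
apply: functional_extensionality_dep => k; rewrite hsum_sumE.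
have [ik|ik] := eqVneq i k.
  case: _ / ik; rewrite hsum_inj_in {1}(eP i (x i)); apply: eq_bigr => j _.
  by rewrite hsum_scaleE hsum_inj_in.
by rewrite hsum_inj_out// big1// => j _; rewrite hsum_scaleE hsum_inj_out// scaler0.
Qed.

Lemma finite_dim_bounded X Y (A : X -> Y) : finite_dim X -> linear A -> bounded_op A.
Proof.
move=> /finite_dim_onb[n [e [eo eX]]] lA; split=> //.
exists (\sum_i `|e i| * `|A (e i)|) => x.
rewrite {1}(eX x) linear_fun_comb// (le_trans (ler_norm_sum _ _ _))// mulr_suml.
apply: ler_sum => i _; rewrite normrZ mulrAC ler_wpM2r// mulrC.
exact: hdot_le.
Qed.

(** [adjoint] is a choice, so an operator with the defining property has to be exhibited; an
    orthonormal basis gives it explicitly. *)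
Lemma adjoint_dot X Y (A : X -> Y) : finite_dim X -> bounded_op A ->
  bounded_op (adjoint A) /\ forall x y, hdot (A x) y = hdot x (adjoint A y).
Proof.
move=> fX bA; have [n [e [eo eX]]] := finite_dim_onb fX; have [lA _] := bA.
pose B y := \sum_i hdot y (A (e i)) *: e i.
have := @xgetPex _ (fun=> 0)
  [set B | bounded_op B /\ forall x y, hdot (A x) y = hdot x (B y)]; apply.
exists B; split.
  split=> [a x y|].
    rewrite /B scaler_sumr -big_split; apply: eq_bigr => i _ /=.
    by rewrite linearDl/= linearZl_LR/= scalerDl scalerA.
  exists (\sum_i `|A (e i)| * `|e i|) => y.
  rewrite (le_trans (ler_norm_sum _ _ _))// mulr_suml.
  apply: ler_sum => i _; rewrite normrZ mulrAC ler_wpM2r// mulrC.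
  exact: hdot_le.
move=> x y; rewrite {1}(eX x) linear_fun_comb// linear_sumlz/= /B linear_sumr/=.
apply: eq_bigr => i _; rewrite linearZl_LR/= linearZr_LR/=.
by rewrite -hdot_conj mulrC.
Qed.

(** An orthonormal family that could not be extended would span the space. *)
Lemma infinite_orthonormal H : ~ finite_dim H -> forall n,
  exists e : 'I_n -> H, orthonormal_fam hdot e.
Proof.
move=> nfH; elim=> [|n [e eo]].
  have f : 'I_0 -> H by case.
  by exists f => -[].
have [y ye] : exists y, y != \sum_i hdot y (e i) *: e i.
  apply: contrapT => /forallNP ne; apply: nfH; apply: (@finite_dim_fam _ _ e) => x.
  by exists (fun i => hdot x (e i)); apply/eqP/negPn/negP/ne.
by have [e' [e'o _ _ _]] := orthonormal_extend eo ye; exists e'.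
Qed.

(** [W] projects onto the span of [eta], writes the projection in terms of [eta] and replaces [eta]
    by [xi]. The [eta i] may be dependent: the hypothesis makes every linear relation among them
    hold among the [xi i]. *)
Lemma douglas X Y (I : finType) (eta : I -> X) (xi : I -> Y) (d : R) : 0 <= d ->
  (forall c : I -> R[i], `|\sum_i c i *: xi i| <= d%:C * `|\sum_i c i *: eta i|) ->
  exists W, [/\ linear W, forall x, `|W x| <= d%:C * `|x| & forall i, W (eta i) = xi i].
Proof.
move=> d0 le; have [n [b [bo bs bP]]] := orthonormal_span hdot eta.
have cb j : exists c : I -> R[i], b j = \sum_i c i *: eta i.
  apply: (bP (fun x => exists c : I -> R[i], x = \sum_i c i *: eta i)); last first.
    move=> i; exists (fun k => (k == i)%:R); rewrite (bigD1 i)//= eqxx scale1r.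
    by rewrite big1 ?addr0// => k /negPf->; rewrite scale0r.
  split=> [|a x y [cx ->] [cy ->]].
    by exists (fun=> 0); rewrite big1// => i _; rewrite scale0r.
  exists (fun i => a * cx i + cy i); rewrite scaler_sumr -big_split.
  by apply: eq_bigr => i _; rewrite /= scalerDl scalerA.
pose c j := projT1 (cid (cb j)).
have cP j : b j = \sum_i c j i *: eta i by rewrite /c; case: cid.
pose q x i := \sum_j hdot x (b j) * c j i.
have qE x : \sum_j hdot x (b j) *: b j = \sum_i q x i *: eta i.
  under eq_bigr do rewrite cP scaler_sumr.
  rewrite exchange_big/=; apply: eq_bigr => i _.
  by rewrite /q scaler_suml; apply: eq_bigr => j _; rewrite scalerA -cP.
exists (fun x => \sum_i q x i *: xi i); split.
- move=> a x y; rewrite scaler_sumr -big_split; apply: eq_bigr => i _ /=.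
  rewrite scalerA -scalerDl; congr (_ *: _).
  rewrite /q mulr_sumr -big_split; apply: eq_bigr => j _ /=.
  by rewrite linearDl/= linearZl_LR/= mulrDl mulrA.
- move=> x; apply: (le_trans (le _)); rewrite -qE ler_wpM2l ?ler0c//.
  exact: bessel.
- move=> i; apply/eqP; rewrite -subr_eq0 -normr_eq0; apply/eqP/le_anti.
  rewrite normr_ge0 andbT.
  have E (Z : lmodType R[i]) (v : I -> Z) : \sum_k q (eta i) k *: v k - v i =
      \sum_k (q (eta i) k - (k == i)%:R) *: v k.
    under [RHS]eq_bigr do rewrite scalerBl.
    rewrite sumrB; congr (_ - _).
    rewrite (bigD1 i)//= eqxx scale1r big1 ?addr0// => k /negPf->.
    by rewrite scale0r.
  (* The coefficients [q (eta i) k - (k == i)%:R] form such a relation: they annihilate [eta], hence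
     [xi]. *)
  rewrite E; apply: (le_trans (le _)).
  by rewrite -E -qE -bs subrr normr0 mulr0.
Qed.

End FiniteDimension.

(** * Factorization of positive definite operators *)

Section PositiveFactor.
Variables (R : realType) (H : hilbertType R) (Gamma : H -> H).
Definition posdef_form (x y : H) : R[i] := hdot (Gamma x) y.

Hypothesis Gpos : posdef_op Gamma.

Let linG : linear Gamma. Proof. by have [[]] := Gpos. Qed.

Let posdef_form_bilinear : bilinear_for ( *%R : R[i] -> _ -> _) (Num.conj \; *%R) posdef_form.
Proof.
split=> z a x y; rewrite /posdef_form; first by rewrite linG linearPl.
by rewrite linearPr.
Qed.

HB.instance Definition _ := @bilinear_isBilinear.Build R[i] H H R[i]
  *%R (Num.conj \; *%R) posdef_form posdef_form_bilinear.

(* Polarization: a sesquilinear form with real diagonal is Hermitian. *)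
Let posdef_form_hermitian x y : posdef_form x y = (-1) ^+ false * Num.conj (posdef_form y x).
Proof.
rewrite expr0 mul1r.
have q_real z : complex.Im (posdef_form z z) = 0.
  apply: ger0_Im; have [->|z0] := eqVneq z 0; first by rewrite linear0r.
  by have [_ /(_ _ z0)/ltW] := Gpos.
have := q_real (x + y); have := q_real (x + 'i *: y).
rewrite !linearDl/= !linearDr/= !linearZl_LR/= !linearZr_LR/=.
move: (q_real x) (q_real y).
case: (posdef_form x x) (posdef_form x y) (posdef_form y x) (posdef_form y y)
  => [a b] [c d] [a' b'] [c' d'].
rewrite /Num.conj /=; simpc; move=> /= -> ->; simpc; move=> /= h1 h2.
apply/eqP; rewrite eq_complex /=; apply/andP; split; apply/eqP; lra.
Qed.

HB.instance Definition _ :=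
  @isHermitianSesquilinear.Build R[i] H false Num.conj posdef_form posdef_form_hermitian.

Let posdef_form_gt0 (x : H) : x != 0 -> 0 < posdef_form x x.
Proof. by have [_] := Gpos; exact. Qed.

HB.instance Definition _ := @isDotProduct.Build R[i] H posdef_form posdef_form_gt0.

(** In place of a square root, [L] carries a basis [f] orthonormal for [posdef_form] to a basis [e]
    orthonormal for [hdot]; it is therefore an isometry from the first inner product to the
    second. *)
Lemma posdef_factor : finite_dim H ->
  exists L L' : H -> H, inverse_op L L' /\ forall x, hdot (Gamma x) x = `|L x| ^+ 2.
Proof.
move=> fH; have [n [e [eo eH]]] := finite_dim_onb fH.
have [m [f [fo fe _]]] := orthonormal_span posdef_form e.
have fH' x : x = \sum_j posdef_form x (f j) *: f j.
  rewrite {1}(eH x); under eq_bigr do rewrite [X in _ *: X]fe scaler_sumr.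
  rewrite exchange_big; apply: eq_bigr => j _.
  rewrite {2}(eH x) linear_sumlz scaler_suml; apply: eq_bigr => i _ /=.
  by rewrite linearZl_LR/= scalerA.
(* The two change of basis matrices are inverse to each other, which forces [f] and [e] to have the
   same length. *)
pose c := \matrix_(j < m, i < n) hdot (f j) (e i).
pose d := \matrix_(i < n, j < m) posdef_form (e i) (f j).
have cd : c *m d = 1%:M.
  apply/matrixP => j j'; rewrite !mxE -fo [in RHS](eH (f j)) linear_sumlz.
  by apply: eq_bigr => i _; rewrite !mxE/= linearZl_LR.
have dc : d *m c = 1%:M.
  apply/matrixP => i i'; rewrite !mxE -eo [in RHS](fH' (e i)) linear_sumlz.
  by apply: eq_bigr => j _; rewrite !mxE/= linearZl_LR.
have nm : n = m.
  by apply/eqP; rewrite eqn_leq (mulmx1_min dc) (mulmx1_min cd).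
case: _ / nm f fo {fe c d cd dc} fH' => f fo fH'.
pose L x := \sum_j posdef_form x (f j) *: e j.
pose L' x := \sum_j hdot x (e j) *: f j.
have lL : linear L.
  move=> a x y; rewrite /L scaler_sumr -big_split; apply: eq_bigr => j _ /=.
  by rewrite linearDl/= linearZl_LR/= scalerDl scalerA.
have LK : cancel L L'.
  move=> x; rewrite [RHS]fH' /L'; apply: eq_bigr => j _.
  by rewrite orthonormal_coord.
have L'K : cancel L' L.
  move=> x; rewrite [RHS]eH /L; apply: eq_bigr => j _.
  by rewrite orthonormal_coord.
exists L, L'; split.
  split=> //; apply: finite_dim_bounded => //; exact: inverse_linear LK L'K.
move=> x; rewrite /L norm_sum_orthonormal// -[LHS]/(posdef_form x x).
rewrite {1 2}(fH' x) orthonormal_dot//.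
by apply: eq_bigr => j _; rewrite normCK.
Qed.

End PositiveFactor.

(** * Theorem of the alternative for Hermitian forms *)

Section QuadraticForm.
Variables (R : realType) (m : nat).

(** The pairing of [B] with the positive semidefinite matrix [X^T *m X], that is, the quadratic form
    of [B] summed over the rows of [X]; for [B = 1] it is the squared Frobenius norm. *)
Definition qform n (X : 'M[R]_(n, m)) (B : 'M[R]_m) := \tr (X *m B *m X^T).

Lemma qformE n (X : 'M[R]_(n, m)) B :
  qform X B = \sum_i \sum_j \sum_l X i l * B l j * X i j.
Proof.
apply: eq_bigr => i _; rewrite mxE; apply: eq_bigr => j _.
by rewrite !mxE mulr_suml.
Qed.

Lemma qformZ n a (X : 'M[R]_(n, m)) B : qform (a *: X) B = a ^+ 2 * qform X B.
Proof.
by rewrite /qform linearZ/= -!scalemxAl -scalemxAr !linearZ/= mulrA expr2.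
Qed.

Lemma qform1E n (X : 'M[R]_(n, m)) : qform X 1%:M = \sum_i \sum_j X i j ^+ 2.
Proof.
rewrite qformE; apply: eq_bigr => k _; apply: eq_bigr => l _.
rewrite (bigD1 l)//= mxE eqxx mulr1 big1 ?addr0// => l' l'l.
by rewrite mxE (negPf l'l) mulr0 mul0r.
Qed.

Lemma qform1_gt0 n (X : 'M[R]_(n, m)) : X != 0 -> 0 < qform X 1%:M.
Proof.
move=> X0; have /existsP[i /existsP[j Xij]] : [exists i, exists j, X i j != 0].
  apply: contraNT X0 => /existsPn X0; apply/eqP/matrixP => i j; rewrite mxE.
  by have /existsPn/(_ j)/negPn/eqP := X0 i.
have Xge k l : 0 <= X k l ^+ 2 by exact: sqr_ge0.
rewrite qform1E (bigD1 i)//= ltr_wpDr//.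
  by apply: sumr_ge0 => k _; exact: sumr_ge0.
rewrite (bigD1 j)//= ltr_wpDr ?exprn_even_gt0//.
exact: sumr_ge0.
Qed.

(** Under the trace each cross term contains [u *m X] or its transpose, hence vanishes. *)
Lemma qform_perturb n (X : 'M[R]_(n, m)) (u : 'rV_n) (w : 'rV_m) b B :
  u *m X = 0 ->
  qform (X + b *: (u^T *m w)) B = qform X B + b ^+ 2 * ((u *m u^T) 0 0 * qform w B).
Proof.
move=> uX; have XTu : X^T *m u^T = 0 by rewrite -trmx_mul uX trmx0.
rewrite /qform linearD/= linearZ/= trmx_mul trmxK !mulmxDl !mulmxDr !mxtraceD.
have -> : \tr (X *m B *m (b *: (w^T *m u))) = 0.
  by rewrite -scalemxAr linearZ/= mulmxA mxtrace_mulC -!mulmxA !mulmxA uX !mul0mx mxtrace0 mulr0.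
have -> : \tr (b *: (u^T *m w) *m B *m X^T) = 0.
  by rewrite -!scalemxAl linearZ/= -!mulmxA mxtrace_mulC -!mulmxA XTu !mulmx0 mxtrace0 mulr0.
rewrite addr0 add0r; congr (_ + _).
rewrite -!scalemxAl -scalemxAr !linearZ/= mulrA expr2; congr (_ * _).
rewrite mulmxA mxtrace_mulC !mulmxA.
have -> : u *m u^T = ((u *m u^T) 0 0)%:M by exact: mx11_scalar.
by rewrite mul_scalar_mx -!scalemxAl linearZ/= !mxE eqxx mulr1n.
Qed.
Lemma continuous_qform n B : continuous (fun x : 'rV[R]_(n * m) => qform (vec_mx x) B).
Proof.
under eq_fun do rewrite qformE.
apply: continuous_big => [|i _]; first exact: add_continuous.
apply: continuous_big => [|j _]; first exact: add_continuous.
apply: continuous_big => [|l _]; first exact: add_continuous.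
have vec_cont k p : continuous (fun x : 'rV[R]_(n * m) => vec_mx x k p).
  by under eq_fun do rewrite mxE; exact: coord_continuous.
move=> x; apply: cvgM (vec_cont i j x).
by apply: cvgM (vec_cont i l x) _; exact: cvg_cst.
Qed.

Lemma compact_qform_sphere n :
  compact [set x : 'rV[R]_(n * m) | qform (vec_mx x) 1%:M = 1].
Proof.
apply: bounded_closed_compact; last first.
  by have /continuous_closedP/(_ _ (@closed_eq R 1)) := @continuous_qform n 1%:M.
exists 1; split=> // M M1 x /= x1; apply: ltW; apply: le_lt_trans M1.
rewrite [`|x|]mx_normrE; apply: bigmax_le => // -[z a] _ /=.
rewrite (ord1 z); case/mxvec_indexP: a => i j.
have -> : x 0 (mxvec_index i j) = vec_mx x i j by rewrite mxE.
rewrite -(@ler_pXn2r _ 2)// ?nnegrE// expr1n real_normK ?num_real// -x1.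
rewrite qform1E (bigD1 i)//= (bigD1 j)//= -addrA lerDl addr_ge0//.
  by apply: sumr_ge0 => l _; exact: sqr_ge0.
by apply: sumr_ge0 => k _; apply: sumr_ge0 => l _; exact: sqr_ge0.
Qed.

End QuadraticForm.

(* The squared length of [(\tr (X A_k X^T))_k] is minimized over the unit sphere
   of matrices with one more row than columns; such an [X] has a left kernel
   vector, along which it can be perturbed with no cross term. *)
Lemma quadratic_alternative (R : realType) (m : nat) (I : finType) (A : I -> 'M[R]_m) :
  (exists2 X : 'M[R]_(m.+1, m), X != 0 & forall k, \tr (X *m A k *m X^T) = 0) \/
  (exists v : I -> R, forall w : 'rV[R]_m, w != 0 ->
     0 < \sum_k v k * (w *m A k *m w^T) 0 0).
Proof.
pose F (X : 'M[R]_(m.+1, m)) := \sum_k qform X (A k) ^+ 2.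
pose S := [set x : 'rV[R]_(m.+1 * m) | qform (vec_mx x) 1%:M = 1 :> R].
have contF : continuous (fun x : 'rV[R]_(m.+1 * m) => F (vec_mx x)).
  rewrite /F; apply: continuous_big => [|k _]; first exact: add_continuous.
  by have c := @continuous_qform R m m.+1 (A k); move=> x; exact: (cvgM (c x) (c x)).
(* Without columns the sphere is empty, but there is no nonzero [w] either. *)
have [m0|m0] := posnP m.
  right; exists (fun=> 0) => w /eqP[]; apply/rowP => -[i im]; exfalso.
  by move: im; rewrite m0.
have sphere (X : 'M[R]_(m.+1, m)) : X != 0 ->
    exists2 Y, qform Y 1%:M = 1 & F X = qform X 1%:M ^+ 2 * F Y.
  move=> /qform1_gt0; set t := qform X _ => t0.
  have s0 : Num.sqrt t != 0 by rewrite gt_eqF// sqrtr_gt0.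
  exists ((Num.sqrt t)^-1 *: X).
    by rewrite qformZ exprVn sqr_sqrtr ?ltW// mulVf// gt_eqF.
  rewrite /F mulr_sumr; apply: eq_bigr => k _.
  rewrite qformZ exprVn sqr_sqrtr ?ltW// exprMn mulrA exprVn divff ?mul1r//.
  by rewrite expf_neq0// gt_eqF.
have nz : const_mx 1 != 0 :> 'M[R]_(m.+1, m).
  apply/eqP => /matrixP/(_ ord0 (Ordinal m0)); rewrite !mxE.
  by apply/eqP; exact: oner_neq0.
have S0 : S !=set0.
  by have [Y Y1 _] := sphere _ nz; exists (mxvec Y); rewrite /S/= mxvecK.
have [x0 x0S min] := compact_EVT_min S0 (@compact_qform_sphere _ _ _)
  (continuous_subspaceT contF).
move: x0S; rewrite inE /S/=; set X := vec_mx x0 => X1.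
(* [F] is homogeneous of degree four, so the minimum over the sphere bounds [F] at every nonzero
   matrix. *)
have minF Y : Y != 0 -> qform Y 1%:M ^+ 2 * F X <= F Y.
  move=> /sphere[Z Z1 ->]; apply: ler_wpM2l; first exact: sqr_ge0.
  by rewrite -[Z]mxvecK; apply: min; rewrite inE /S/= mxvecK.
have X0 : X != 0.
  apply/eqP => X0; move: X1; rewrite X0 /qform !mul0mx mxtrace0 => /esym/eqP.
  by rewrite oner_eq0.
have F_ge0 Y : 0 <= F Y by apply: sumr_ge0 => k _; exact: sqr_ge0.
have [FX0|FX0] := eqVneq (F X) 0.
  left; exists X => // k; apply/eqP; rewrite -sqrf_eq0; apply/eqP.
  by apply: (psumr_eq0P _ FX0) => // i _; exact: sqr_ge0.
have {}FX0 : 0 < F X by rewrite lt_def FX0 F_ge0.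
(* As for a separating hyperplane, the multipliers are the coordinates of the point of the image of
   the sphere nearest to the origin. *)
right; exists (fun k => qform X (A k)) => w w0.
have [u u0 uX] : exists2 u : 'rV[R]_m.+1, u != 0 & u *m X = 0.
  have kX : kermx X != 0.
    by rewrite -mxrank_eq0 mxrank_ker subn_eq0 -ltnNge ltnS rank_leq_col.
  have [i ki] : exists i, row i (kermx X) != 0.
    apply: contrapT => /forallNP k0; case/eqP: kX; apply/row_matrixP => i.
    by rewrite row0; apply/eqP/negPn/negP/k0.
  by exists (row i (kermx X)); rewrite // -row_mul mulmx_ker row0.
have uu : 0 < (u *m u^T) 0 0.
  by have := qform1_gt0 u0; rewrite /qform mulmx1 trace_mx11.
set c := (u *m u^T) 0 0 in uu.
pose p := \sum_k qform X (A k) * (c * qform w (A k)).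
have -> : \sum_k qform X (A k) * (w *m A k *m w^T) 0 0 = c^-1 * p.
  rewrite mulr_sumr; apply: eq_bigr => k _.
  by rewrite /qform trace_mx11 mulrCA mulKf ?gt_eqF.
rewrite mulr_gt0 ?invr_gt0// ltNge; apply/negP => p0.
pose q := \sum_k (c * qform w (A k)) ^+ 2.
have q0 : 0 <= q by apply: sumr_ge0 => k _; exact: sqr_ge0.
pose d := c * qform w 1%:M.
have d0 : 0 < d by rewrite mulr_gt0// qform1_gt0.
(* Suppose [p <= 0]. Moving from [X] to [Y] changes [F] by [2 * s * p + s ^+ 2 * q], whereas
   minimality requires a growth of at least [2 * s * d * F X]. This [s] makes [s * q <= d * F X],
   too little for that growth. *)
pose s := d * F X / (q + 1).
have q1 : 0 < q + 1 by rewrite ltr_wpDl.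
have s0 : 0 < s by rewrite divr_gt0// mulr_gt0.
pose Y := X + Num.sqrt s *: (u^T *m w).
have YB B : qform Y B = qform X B + s * (c * qform w B).
  by rewrite qform_perturb// sqr_sqrtr// ltW.
have Y0 : Y != 0.
  apply/eqP => Y0; have := YB 1%:M; rewrite Y0 X1 /qform !mul0mx mxtrace0 -/d.
  by have := mulr_gt0 s0 d0; lra.
have FY : F Y = F X + 2 * s * p + s ^+ 2 * q.
  rewrite /F /p /q !mulr_sumr -!big_split; apply: eq_bigr => k _.
  by rewrite YB /=; ring.
have sq : s * q <= d * F X.
  have -> : d * F X = s * (q + 1) by rewrite /s divfK// gt_eqF.
  by rewrite ler_pM2l// lerDl.
have := minF _ Y0; rewrite YB X1 -/d FY.
move: (mulr_gt0 s0 d0) (ler_wpM2l (ltW s0) sq) (mulr_ge0_le0 (ltW s0) p0).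
move: (mulr_gt0 (mulr_gt0 s0 d0) FX0) (mulr_ge0 (sqr_ge0 (s * d)) (ltW FX0)).
set a := s * d; set b := s * p; set f := F X => h1 h2 h3 h4 h5 h6.
have e1 : s * (d * f) = a * f by rewrite mulrA.
have e2 : s * (s * q) = s ^+ 2 * q by rewrite mulrA expr2.
rewrite e1 e2 in h4.
have e3 : (1 + a) ^+ 2 * f = f + 2 * (a * f) + a ^+ 2 * f by ring.
rewrite e3 -mulrA -/b in h6.
lra.
Qed.

Section HermitianAlternative.
Variables (R : realType) (Z : hilbertType R) (J : finType) (B : J -> Z -> Z -> R[i]).
Hypothesis Bl : forall k z a x y, B k (a *: x + y) z = a * B k x z + B k y z.
Hypothesis Br : forall k z a x y, B k z (a *: x + y) = Num.conj a * B k z x + B k z y.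

Lemma sesqui_sum (I : finType) (c d : I -> R[i]) (b : I -> Z) k :
  B k (\sum_i c i *: b i) (\sum_i d i *: b i) =
  \sum_i \sum_j c i * Num.conj (d j) * B k (b i) (b j).
Proof.
have l z : linear (fun x => B k x z : R[i]^o) by move=> a x y; exact: Bl.
have B0 z : B k z 0 = 0.
  by have := Br k z (-1) 0 0; rewrite scaler0 addr0 rmorphN1 mulN1r addNr.
rewrite (linear_fun_comb (l _)); apply: eq_bigr => i _.
rewrite -[_ *: _]/(c i * B k (b i) _).
have -> : B k (b i) (\sum_j d j *: b j) = \sum_j Num.conj (d j) * B k (b i) (b j).
  by elim/big_rec2: _ => [|j y x _ <-]; rewrite ?B0// Br.
by rewrite mulr_sumr; apply: eq_bigr => j _; rewrite mulrA.
Qed.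

(** [Z] is read as a real space with basis [e i], ['i *: e i], and each form contributes its real
    and its imaginary part, indexed by [J * bool], to the real alternative. *)
Lemma hermitian_alternative : finite_dim Z ->
  (exists n (z : 'I_n -> Z), (exists j, z j != 0) /\
     forall k, \sum_j B k (z j) (z j) = 0) \/
  (exists v : J -> R[i], forall z, z != 0 ->
     0 < \sum_k complex.Re (v k * B k z z)).
Proof.
move=> /finite_dim_onb[n [e [eo eZ]]].
pose b (a : 'I_(n + n)) := match fintype.split a with inl i => e i | inr i => 'i *: e i end.
pose V (w : 'I_(n + n) -> R) := \sum_a (w a)%:C *: b a.
have VE w : V w = \sum_i ((w (lshift n i))%:C + 'i * (w (rshift n i))%:C) *: e i.
  rewrite /V big_split_ord /= -big_split; apply: eq_bigr => i _ /=.
  rewrite /b -[lshift n i]/(unsplit (inl i)) -[rshift n i]/(unsplit (inr i)) !unsplitK.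
  by rewrite scalerA scalerDl [_ * 'i]mulrC.
have V0 w : V w = 0 -> forall a, w a = 0.
  move=> w0 a.
  have wi i : (w (lshift n i))%:C + 'i * (w (rshift n i))%:C = 0.
    have := orthonormal_coord (fun i => (w (lshift n i))%:C + 'i * (w (rshift n i))%:C) i eo.
    by rewrite -VE w0 hdot0l.
  rewrite -[a]fintype.splitK; case: (fintype.split a) => i; have := wi i; simpc => /eqP;
    by rewrite eq_complex /= => /andP[/eqP ? /eqP ?].
have VS z : exists w, z = V w.
  exists (fun a => match fintype.split a with inl i => complex.Re (hdot z (e i))
    | inr i => complex.Im (hdot z (e i)) end).
  rewrite VE {1}(eZ z); apply: eq_bigr => i _.
  rewrite -[lshift n i]/(unsplit (inl i)) -[rshift n i]/(unsplit (inr i)) !unsplitK.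
  by rewrite -complexE.
pose part (c : bool) (x : R[i]) := if c then complex.Re x else complex.Im x.
have partD c : {morph part c : x y / x + y} by case: c => -[? ?] [].
have part0 c : part c 0 = 0 by case: c.
have partZ c (r : R) x : part c (r%:C * x) = r * part c x.
  by case: c x => -[x y] /=; rewrite !(mul0r, subr0, addr0).
pose A (kc : J * bool) := \matrix_(i, j) part kc.2 (B kc.1 (b i) (b j)).
have AE kc w : \sum_j \sum_i w i * A kc i j * w j = part kc.2 (B kc.1 (V w) (V w)).
  rewrite sesqui_sum exchange_big (big_morph _ (partD _) (part0 _)).
  apply: eq_bigr => i _; rewrite (big_morph _ (partD _) (part0 _)).
  apply: eq_bigr => j _; rewrite mxE -[Num.conj _]/((w j)%:C^*%C) conjc_real.
  by rewrite -rmorphM partZ mulrAC.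
have [[X X0 XA]|[v vA]] := quadratic_alternative A; [left | right].
  exists (n + n).+1, (fun j => V (X j)); split.
    apply: contrapT => /forallNP z0; case/eqP: X0; apply/matrixP => j a.
    by rewrite mxE; apply: V0; apply/eqP/negPn/negP/z0.
  move=> k; apply/eqP; rewrite eq_complex; apply/andP; split; apply/eqP.
    rewrite -[LHS]/(part true _) (big_morph _ (partD _) (part0 _)) /=.
  have := XA (k, true); rewrite -/(qform _ _) => q0; rewrite -[RHS]q0.
    rewrite qformE; apply: eq_bigr => j _.
    exact: esym (AE (k, true) _).
  rewrite -[LHS]/(part false _) (big_morph _ (partD _) (part0 _)) /=.
  have := XA (k, false); rewrite -/(qform _ _) => q0; rewrite -[RHS]q0.
  rewrite qformE; apply: eq_bigr => j _.
  exact: esym (AE (k, false) _).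
(* The minus sign makes the real part of the product equal to [v (k, true)] times the real part plus
   [v (k, false)] times the imaginary part. *)
exists (fun k => (v (k, true)) -i* (v (k, false))) => z z0.
have [w zw] := VS z.
have w0 : \row_a w a != 0.
  apply: contraNneq z0 => /rowP w0; rewrite zw /V big1// => a _.
  by have := w0 a; rewrite !mxE => ->; rewrite scale0r.
have := vA _ w0; congr (_ < _).
have E kc : (\row_a w a *m A kc *m (\row_a w a)^T) 0 0 = part kc.2 (B kc.1 z z).
  rewrite -trace_mx11 -/(qform _ _) qformE big_ord1 zw -AE.
  by apply: eq_bigr => j _; apply: eq_bigr => i _; rewrite !mxE.
rewrite (eq_bigr (fun kc => v (kc.1, kc.2) * part kc.2 (B kc.1 z z))); last first.
  by move=> [k c] _; rewrite E.
rewrite -(pair_bigA _ (fun k c => v (k, c) * part c (B k z z))) /=.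
apply: eq_bigr => k _; rewrite big_bool /part /=.
by case: (B k z z) => x y /=; rewrite mulNr opprK.
Qed.

End HermitianAlternative.

(** * Hilbert tensor products *)

Lemma hdot_suml (R : realType) (X : hilbertType R) (I : finType) (f : I -> X) x :
  hdot (\sum_i f i) x = \sum_i hdot (f i) x.
Proof. by rewrite linear_sumlz. Qed.

Lemma hdot_sumr (R : realType) (X : hilbertType R) (I : finType) (f : I -> X) x :
  hdot x (\sum_i f i) = \sum_i hdot x (f i).
Proof. by rewrite linear_sumr. Qed.

Section TensorNorm.
Variables (R : realType) (K A : hilbertType R) (T : hilbert_tensor K A).

Lemma norm_tens k h : `|tens T k h| = `|k| * `|h|.
Proof.
apply/eqP; rewrite -(@eqrXn2 _ 2)// ?mulr_ge0// exprMn -!hdot_norm.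
by rewrite hdot_tens.
Qed.

Lemma norm_tens_sumr (I : finType) (e : I -> A) (k : I -> K) :
  orthonormal_fam hdot e -> `|\sum_i tens T (k i) (e i)| ^+ 2 = \sum_i `|k i| ^+ 2.
Proof.
move=> eo; rewrite -hdot_norm hdot_suml; apply: eq_bigr => i _.
rewrite hdot_sumr (bigD1 i)//= hdot_tens eo eqxx mulr1 hdot_norm.
by rewrite big1 ?addr0// => j ji; rewrite hdot_tens eo eq_sym (negPf ji) mulr0.
Qed.

Lemma norm_tens_suml (I : finType) (b : I -> K) (h : I -> A) :
  orthonormal_fam hdot b -> `|\sum_i tens T (b i) (h i)| ^+ 2 = \sum_i `|h i| ^+ 2.
Proof.
move=> bo; rewrite -hdot_norm hdot_suml; apply: eq_bigr => i _.
rewrite hdot_sumr (bigD1 i)//= hdot_tens bo eqxx mul1r hdot_norm.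
by rewrite big1 ?addr0// => j ji; rewrite hdot_tens bo eq_sym (negPf ji) mul0r.
Qed.

Lemma tens_expand n (e : 'I_n -> A) k h : is_onb e ->
  tens T k h = \sum_i tens T (hdot h (e i) *: k) (e i).
Proof.
move=> [_ eA]; rewrite {1}(eA h) linear_sumr; apply: eq_bigr => i _ /=.
by rewrite linearZr_LR linearZl_LR.
Qed.

Variables (n : nat) (e : 'I_n -> A).
Hypothesis eb : is_onb e.

Definition tens_of (k : hsum (fun _ : 'I_n => K)) : tensor_space T :=
  \sum_i tens T (k i) (e i).

Lemma tens_of_linear : linear tens_of.
Proof.
move=> a x y; rewrite /tens_of scaler_sumr -big_split; apply: eq_bigr => i _ /=.
by rewrite hsum_addE hsum_scaleE linearPl.
Qed.

Lemma norm_tens_of k : `|tens_of k| = `|k|.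
Proof.
apply/eqP; rewrite -(@eqrXn2 _ 2)//.
by rewrite /tens_of norm_tens_sumr ?hsum_normE//; case: eb.
Qed.

Lemma tens_of_tens k h : tens T k h = tens_of (fun i => hdot h (e i) *: k).
Proof. exact: tens_expand. Qed.

(** [tens_of] is isometric and reaches all finite sums of pure tensors, which are dense. *)
Lemma tens_of_surj x : exists k, tens_of k = x.
Proof.
apply: (bounded_below_dense_surj tens_of_linear ltr01 ltr01) => [k|k|y d d0].
- by rewrite norm_tens_of mul1r.
- by rewrite norm_tens_of mul1r.
have /denseP_norm/(_ y d d0)[z [s ->] yz] := @tens_dense R K A T.
exists (\sum_(p <- s) ((fun i => hdot p.2 (e i) *: p.1) : hsum (fun _ : 'I_n => K))).
rewrite (linear_fun_sum tens_of_linear); move: yz; congr (`|_ - _| < _).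
by apply: eq_bigr => p _; exact: tens_of_tens.
Qed.

Lemma tensor_decomp x : exists k : 'I_n -> K, x = \sum_i tens T (k i) (e i).
Proof. by have [k <-] := tens_of_surj x; exists k. Qed.

End TensorNorm.

(** * Operators on Hilbert tensor products *)

Section TensorOperators.
Variable R : realType.
Implicit Types K A : hilbertType R.

Lemma tensor_ext K A (T : hilbert_tensor K A) (X : hilbertType R)
    (D D' : tensor_space T -> X) : finite_dim A -> linear D -> linear D' ->
  (forall k h, D (tens T k h) = D' (tens T k h)) -> D =1 D'.
Proof.
move=> /finite_dim_onb[n [e eb]] lD lD' DD' x.
have [k ->] := tensor_decomp eb x.
by rewrite !linear_fun_sum//; apply: eq_bigr => i _; exact: DD'.
Qed.

(** The choice in [tensor_op] needs a witness. It is built on the coordinates [J'] with respect to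
    an orthonormal basis of [A]. *)
Lemma tensor_opP K A K' A' (T : hilbert_tensor K A) (T' : hilbert_tensor K' A')
    (W : K -> K') (B : A -> A') : finite_dim A -> bounded_op W -> linear B ->
  bounded_op (tensor_op T T' W B) /\
  forall k h, tensor_op T T' W B (tens T k h) = tens T' (W k) (B h).
Proof.
move=> /finite_dim_onb[n [e eb]] bW lB; have [lW _] := bW.
have [w w0 Ww] := bounded_opP bW.
have := @xgetPex _ (fun=> 0) [set D | bounded_op D /\
  forall k h, D (tens T k h) = tens T' (W k) (B h)]; apply.
have lJ := tens_of_linear T e.
pose J' (x : tensor_space T) := projT1 (cid (tens_of_surj eb x)).
have J'K : cancel J' (tens_of T e) by move=> x; rewrite /J'; case: cid.
have JK : cancel (tens_of T e) J'.
  move=> x; apply/eqP; rewrite -subr_eq0 -normr_eq0 -(norm_tens_of T eb).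
  by rewrite (linear_funB lJ) J'K subrr normr0.
have lJ' : linear J' := inverse_linear lJ JK J'K.
have J'n x : `|J' x| = `|x| by rewrite -(norm_tens_of T eb) J'K.
exists (fun x => \sum_i tens T' (W (J' x i)) (B (e i))); split.
  split=> [a x y|].
    rewrite lJ' scaler_sumr -big_split; apply: eq_bigr => i _ /=.
    by rewrite hsum_addE hsum_scaleE lW linearPl.
  exists (\sum_i w%:C * `|B (e i)|) => x.
  rewrite (le_trans (ler_norm_sum _ _ _))// mulr_suml; apply: ler_sum => i _.
  rewrite norm_tens mulrAC ler_wpM2r// (le_trans (Ww _))// ler_wpM2l//.
    by rewrite ler0c ltW.
  by rewrite -(J'n x); exact: hsum_norm_coord.
move=> k h; rewrite (tens_of_tens T eb) JK.
rewrite [in RHS](eb.2 h) (linear_fun_comb lB) linear_sumr; apply: eq_bigr => i _ /=.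
by rewrite (linear_funZ lW) linearZl_LR linearZr_LR.
Qed.

Lemma tensor_op_id_le K A K' (T : hilbert_tensor K A) (T' : hilbert_tensor K' A)
    (W : K -> K') (c : R) : finite_dim A -> linear W -> 0 <= c ->
  (forall k, `|W k| <= c%:C * `|k|) ->
  forall x, `|tensor_op T T' W idfun x| <= c%:C * `|x|.
Proof.
move=> fA lW c0 Wc x; have [n [e eb]] := finite_dim_onb fA.
have bW : bounded_op W by exact: linear_bounded_op lW Wc.
have lI : linear (idfun : A -> A) by [].
have [[lD _] DE] := tensor_opP T T' fA bW lI.
have [k ->] := tensor_decomp eb x.
rewrite -(@ler_pXn2r _ 2)// ?nnegrE ?mulr_ge0 ?ler0c// exprMn.
rewrite (linear_fun_sum lD); under eq_bigr do rewrite DE.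
rewrite !norm_tens_sumr; try exact: eb.1.
rewrite mulr_sumr; apply: ler_sum => i _.
by rewrite -exprMn ler_pXn2r// ?nnegrE ?mulr_ge0 ?ler0c.
Qed.

(** [B] destroys the orthogonality of the [e i], so the finitely many coefficients in [K] are
    orthonormalized instead and the vector is expanded along them. *)
Lemma id_tensor_op_le K A A' (T : hilbert_tensor K A) (T' : hilbert_tensor K A')
    (B : A -> A') (c : R) : finite_dim A -> linear B -> 0 <= c ->
  (forall h, `|B h| <= c%:C * `|h|) ->
  forall x, `|tensor_op T T' idfun B x| <= c%:C * `|x|.
Proof.
move=> fA lB c0 Bc x; have [n [e eb]] := finite_dim_onb fA.
have bI : bounded_op (idfun : K -> K).
  by apply: (@linear_bounded_op _ _ _ _ 1) => // y; rewrite mul1r.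
have [[lD _] DE] := tensor_opP T T' fA bI lB.
have [k ->] := tensor_decomp eb x.
have [m [b [bo bs _]]] := orthonormal_span hdot k.
pose h j := \sum_i hdot (k i) (b j) *: e i.
have -> : \sum_i tens T (k i) (e i) = \sum_j tens T (b j) (h j).
  under eq_bigr do rewrite {1}bs linear_sumlz.
  rewrite exchange_big; apply: eq_bigr => j _ /=.
  rewrite linear_sumr; apply: eq_bigr => i _ /=.
  by rewrite linearZl_LR linearZr_LR.
rewrite -(@ler_pXn2r _ 2)// ?nnegrE ?mulr_ge0 ?ler0c// exprMn.
rewrite (linear_fun_sum lD); under eq_bigr do rewrite DE.
rewrite !norm_tens_suml// mulr_sumr; apply: ler_sum => j _.
by rewrite -exprMn ler_pXn2r// ?nnegrE ?mulr_ge0 ?ler0c.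
Qed.

End TensorOperators.

Section IdTensor.
Variables (R : realType) (K : hilbertType R).
Implicit Types A : hilbertType R.

Lemma linear_idfun A : linear (idfun : A -> A).
Proof. by []. Qed.

Lemma bounded_idfun A : bounded_op (idfun : A -> A).
Proof. by apply: (@linear_bounded_op _ _ _ _ 1) => // y; rewrite mul1r. Qed.

Lemma id_tensor_opP A A' (T : hilbert_tensor K A) (T' : hilbert_tensor K A')
    (B : A -> A') : finite_dim A -> linear B ->
  bounded_op (tensor_op T T' idfun B) /\
  forall k h, tensor_op T T' idfun B (tens T k h) = tens T' k (B h).
Proof. by move=> fA lB; exact: tensor_opP fA (bounded_idfun _) lB. Qed.

Lemma id_tensor_op_comp A A' A'' (T : hilbert_tensor K A) (T' : hilbert_tensor K A')
    (T'' : hilbert_tensor K A'') (B : A -> A') (B' : A' -> A'') x :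
  finite_dim A -> finite_dim A' -> linear B -> linear B' ->
  tensor_op T' T'' idfun B' (tensor_op T T' idfun B x) =
  tensor_op T T'' idfun (B' \o B) x.
Proof.
move=> fA fA' lB lB'.
have lBB : linear (B' \o B) by move=> a y z /=; rewrite lB lB'.
have [[l1 _] E1] := id_tensor_opP T T' fA lB.
have [[l2 _] E2] := id_tensor_opP T' T'' fA' lB'.
have [[l3 _] E3] := id_tensor_opP T T'' fA lBB.
apply: (tensor_ext (D := tensor_op T' T'' idfun B' \o tensor_op T T' idfun B) fA) => //.
  by move=> a y z /=; rewrite l1 l2.
by move=> k h /=; rewrite E1 E2 E3.
Qed.

Lemma id_tensor_op_id A (T : hilbert_tensor K A) x : finite_dim A ->
  tensor_op T T idfun idfun x = x.
Proof.
move=> fA; have lI : linear (idfun : A -> A) by [].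
have [[l1 _] E1] := id_tensor_opP T T fA lI.
by apply: (tensor_ext (D' := idfun) fA) => // k h; rewrite E1.
Qed.

Lemma id_tensor_op_inverse A (T : hilbert_tensor K A) (X X' : A -> A) :
  finite_dim A -> inverse_op X X' ->
  inverse_op (tensor_op T T idfun X) (tensor_op T T idfun X').
Proof.
move=> fA [[lX _] [lX' _] XK X'K].
have [b1 _] := id_tensor_opP T T fA lX; have [b2 _] := id_tensor_opP T T fA lX'.
split=> // x; rewrite id_tensor_op_comp//.
  by have -> : X' \o X = idfun; [exact/funext | exact: id_tensor_op_id].
by have -> : X \o X' = idfun; [exact/funext | exact: id_tensor_op_id].
Qed.

End IdTensor.

(** * Scaling bound *)

Section Commutation.
Variables (R : realType) (G : bipartite_graph) (K : hilbertType R).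
Variables (H : component G -> hilbertType R) (hH : forall p, finite_dim (H p)).
Variable T : forall p, hilbert_tensor K (H p).

Lemma finite_dim_HS : finite_dim (HS H).
Proof. by do 2![apply: finite_dim_hsum => ?]; exact: hH. Qed.

Lemma finite_dim_HR : finite_dim (HR H).
Proof. by do 2![apply: finite_dim_hsum => ?]; exact: hH. Qed.

Lemma op_tensor_idP p (W : KRp K p -> KSp K p) : bounded_op W ->
  linear (op_tensor_id (T := T) W) /\
  forall (y : KRp K p) h, op_tensor_id (T := T) W (tens (tensor_suml (fun _ => T p)) y h) =
    tens (tensor_suml (fun _ => T p)) (W y) h.
Proof.
move=> bW.
have [[lD _] E] := tensor_opP (tensor_suml (fun _ : comp_range p => T p))
  (tensor_suml (fun _ : comp_source p => T p)) (@hH p) bW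
  (@linear_idfun _ (H p)).
by split.
Qed.

Lemma Delta_Gbar_linear D : Delta_Gbar (T := T) D -> linear D.
Proof.
move=> [W bW ->] a x y; apply: functional_extensionality_dep => p.
exact: (op_tensor_idP (bW p)).1.
Qed.

Lemma Delta_Gbar_le (W : forall p, KRp K p -> KSp K p) (c : R) :
  (forall p, linear (W p)) -> 0 <= c -> (forall p x, `|W p x| <= c%:C * `|x|) ->
  forall x, `|(hsum_op (fun p => op_tensor_id (T := T) (W p)) x : KHS T)| <= c%:C * `|x|.
Proof.
move=> lW c0 Wc x.
rewrite -(@ler_pXn2r _ 2)// ?nnegrE ?mulr_ge0 ?ler0c// exprMn !hsum_normE.
rewrite mulr_sumr; apply: ler_sum => p _.
rewrite -exprMn ler_pXn2r// ?nnegrE ?mulr_ge0 ?ler0c//.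
exact: (tensor_op_id_le (T := tensor_suml (fun _ : comp_range p => T p))
  (tensor_suml (fun _ : comp_source p => T p)) (hH p) (lW p) c0 (Wc p)).
Qed.

Let edges := {p : component G & (comp_source p * comp_range p)%type}.

Definition matrix_unit (u : edges) : HR H -> HS H :=
  hsum_op (fun p => matrix_tensor_id
    (fun s r => (Tagged (fun p => (comp_source p * comp_range p)%type) (s, r) == u)%:R)).

Lemma matrix_unit_Delta u : Delta_G (matrix_unit u).
Proof. by eexists. Qed.

(** An element of the enhanced structure is a combination of the matrix units of [Delta_G] whose
    coefficients [w u], the entries of [W], act on [K]. Commutation with [Delta_G] therefore passes
    to [Delta_Gbar]. *)
Lemma Delta_Gbar_tens D : Delta_Gbar (T := T) D -> exists w : edges -> K -> K,
  forall k h, D (tens (tensor_HR T) k h) =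
    \sum_u tens (tensor_HS T) (w u k) (matrix_unit u h).
Proof.
move=> [W bW ->].
exists (fun u k => W (tag u) (hsum_inj (X := fun=> K) (i := (tagged u).2) k) (tagged u).1) => k h.
apply: functional_extensionality_dep => p.
have [lD DE] := op_tensor_idP (bW p).
rewrite hsum_sumE.
(* The same vector, reread in the tensor product of [KRp K p] with [H p], where [op_tensor_id] is
   defined. *)
have kE : (tens (tensor_HR T) k h) p =
    \sum_(r : comp_range p) tens (tensor_suml (fun _ => T p))
      (hsum_inj (X := fun=> K) (i := r) k) (h p r).
  apply: functional_extensionality_dep => r; rewrite hsum_sumE (bigD1 r)//= big1 ?addr0.
    by rewrite /tens_suml hsum_inj_in.
  by move=> r' r'r; rewrite /tens_suml hsum_inj_out ?linear0l.
rewrite /hsum_op kE (linear_fun_sum lD).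
apply: functional_extensionality_dep => s; rewrite !hsum_sumE.
under eq_bigr do rewrite DE.
transitivity (\sum_(r : comp_range p) tens (T p)
    (W p (hsum_inj (X := fun=> K) (i := r) k) s) (h p r)).
  done.
pose f (u : edges) r := tens (T p)
  (W (tag u) (hsum_inj (X := fun=> K) (i := (tagged u).2) k) (tagged u).1)
  ((Tagged (fun p => (comp_source p * comp_range p)%type) (s, r) == u)%:R *: h p r).
transitivity (\sum_u \sum_r f u r).
  rewrite exchange_big; apply: eq_bigr => r _ /=.
  rewrite (bigD1 (Tagged (fun p => (comp_source p * comp_range p)%type) (s, r)))//= /f.
  rewrite eqxx scale1r big1 ?addr0//= => u ur.
  by rewrite eq_sym (negPf ur) scale0r linear0r.
by apply: eq_bigr => u _; rewrite /f -linear_sumr.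
Qed.

Lemma Delta_Gbar_commute D X Y x : Delta_Gbar (T := T) D ->
  commutant (Delta_G (H := H)) (X, Y) ->
  tensor_op (tensor_HS T) (tensor_HS T) idfun Y (D x) =
  D (tensor_op (tensor_HR T) (tensor_HR T) idfun X x).
Proof.
move=> DG [/= [lX _] [lY _] XY].
have [[l1 _] E1] := id_tensor_opP (tensor_HR T) (tensor_HR T) finite_dim_HR lX.
have [[l2 _] E2] := id_tensor_opP (tensor_HS T) (tensor_HS T) finite_dim_HS lY.
have lD := Delta_Gbar_linear DG.
apply: (tensor_ext (T := tensor_HR T)
  (D := fun x => tensor_op (tensor_HS T) (tensor_HS T) idfun Y (D x))
  (D' := fun x => D (tensor_op (tensor_HR T) (tensor_HR T) idfun X x)) finite_dim_HR).
- by move=> a y z; rewrite lD l2.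
- by move=> a y z; rewrite l1 lD.
have [w DE] := Delta_Gbar_tens DG.
move=> k h; rewrite DE E1 DE (linear_fun_sum l2); apply: eq_bigr => u _.
rewrite E2; congr (tens _ _ _).
by have /(congr1 (@^~ h)) := XY _ (matrix_unit_Delta u).
Qed.

Lemma scaling_bound (M : HS H -> HR H) D X X' Y Y' : linear M ->
  Delta_Gbar (T := T) D -> bounded_op D -> commutant (Delta_G (H := H)) (X, Y) ->
  inverse_op X X' -> inverse_op Y Y' ->
  spectrum (tensor_op (tensor_HS T) (tensor_HR T) idfun M \o D) 1 ->
  1 <= opnorm (X \o M \o Y') * opnorm D.
Proof.
move=> lM DG bD XY iX iY sp; rewrite leNgt; apply/negP => lt1; apply: sp.
have fS := finite_dim_HS; have fR := finite_dim_HR.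
have bM : bounded_op M by exact: finite_dim_bounded.
have [[lX _] [lX' _] XK _] := iX; have [[lY _] [lY' _] YK Y'K] := iY.
have bZ : bounded_op (X \o M \o Y').
  by apply: bounded_comp; [case: iY | apply: bounded_comp => //; case: iX].
set Z := X \o M \o Y' in bZ lt1; have [lZ _] := bZ.
pose A := tensor_op (tensor_HS T) (tensor_HR T) idfun Z \o D.
have [[l1 _] E1] := id_tensor_opP (tensor_HS T) (tensor_HR T) fS lZ.
have [lD _] := bD.
have lA : linear A by move=> a x y; rewrite /A /= lD l1.
have Ac x : `|A x| <= (opnorm Z * opnorm D)%:C * `|x|.
  rewrite /A /= (le_trans (id_tensor_op_le (tensor_HR T) fS lZ (opnorm_ge0 bZ) _ _))//.
    by move=> h; exact: opnormP.
  by rewrite rmorphM -mulrA ler_wpM2l ?ler0c ?opnorm_ge0// opnormP.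
have [B iB] := contraction_resolvent lA (mulr_ge0 (opnorm_ge0 bZ) (opnorm_ge0 bD)) lt1 Ac.
have iIX := id_tensor_op_inverse (tensor_HR T) fR iX.
eexists.
have := inverse_op_comp iIX (inverse_op_comp iB (inverse_op_sym iIX)).
congr (inverse_op _ _); apply/funext => x /=.
have [_ [l2 _] IXK _] := iIX.
rewrite scale1r (linear_funB l2) IXK; congr (_ - _).
(* Once [D] has been moved past the scaling, [X' Z Y] collapses to [M]. *)
rewrite /A /= -(Delta_Gbar_commute _ DG XY).
rewrite !id_tensor_op_comp//; last by move=> a y z; rewrite /= lZ lX'.
have -> : (X' \o Z) \o Y = M by apply/funext => y; rewrite /Z /= YK XK.
by [].
Qed.

End Commutation.

(** * From the linear matrix inequality to a scaling *)

Section Scaling.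
Variables (R : realType) (G : bipartite_graph).
Variables (H : component G -> hilbertType R) (hH : forall p, finite_dim (H p)).
Variables (M : HS H -> HR H) (lM : linear M).

Lemma hdot_hsum (I : finType) (X : I -> hilbertType R) (x y : hsum X) :
  hdot x y = \sum_i hdot (x i) (y i).
Proof. by []. Qed.

Lemma hsum_op_linear (I : finType) (X Y : I -> hilbertType R) (A : forall i, X i -> Y i) :
  (forall i, linear (A i)) -> linear (hsum_op A).
Proof.
move=> lA a x y; apply: functional_extensionality_dep => i.
by rewrite /hsum_op !hsum_addE !hsum_scaleE lA.
Qed.

Lemma hsum_op_inverse (I : finType) (X Y : I -> hilbertType R)
    (A : forall i, X i -> Y i) (B : forall i, Y i -> X i) :
  (forall i, finite_dim (X i)) -> (forall i, finite_dim (Y i)) ->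
  (forall i, inverse_op (A i) (B i)) -> inverse_op (hsum_op A) (hsum_op B).
Proof.
move=> fX fY iAB; split.
- apply: finite_dim_bounded; first exact: finite_dim_hsum.
  by apply: hsum_op_linear => i; have [[]] := iAB i.
- apply: finite_dim_bounded; first exact: finite_dim_hsum.
  by apply: hsum_op_linear => i; have [_ []] := iAB i.
- move=> x; apply: functional_extensionality_dep => i.
  by have [_ _ AK _] := iAB i; exact: AK.
- move=> x; apply: functional_extensionality_dep => i.
  by have [_ _ _ BK] := iAB i; exact: BK.
Qed.

Lemma hsum_op_dot (I : finType) (X : I -> hilbertType R) (A L : forall i, X i -> X i) :
  (forall i x, hdot (A i x) x = `|L i x| ^+ 2) ->
  forall x : hsum X, hdot (hsum_op A x) x = `|(hsum_op L x : hsum X)| ^+ 2.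
Proof. by move=> AL x; rewrite hdot_hsum hsum_normE; apply: eq_bigr => i _; exact: AL. Qed.

Lemma gamma_commutant (L : forall p, H p -> H p) : (forall p, linear (L p)) ->
  commutant (Delta_G (H := H)) (gamma_range L, gamma_source L).
Proof.
move=> lL; split=> /=.
- apply: finite_dim_bounded; first exact: finite_dim_HR.
  by do 2![apply: hsum_op_linear => ?]; exact: lL.
- apply: finite_dim_bounded; first exact: finite_dim_HS.
  by do 2![apply: hsum_op_linear => ?]; exact: lL.
move=> _ [W ->]; apply/funext => x.
apply: functional_extensionality_dep => p; apply: functional_extensionality_dep => s.
by rewrite /= /gamma_source /gamma_range /hsum_op /matrix_tensor_id (linear_fun_comb (lL p)).
Qed.

(** The inequality of the theorem at level [t], stated through quadratic forms so that no adjoint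
    occurs; the theorem needs [t = 1]. *)
Definition lmi_at (t : R) (Gamma : forall p, H p -> H p) :=
  forall x : HS H, x != 0 ->
    hdot (gamma_range Gamma (M x)) (M x) < (t ^+ 2)%:C * hdot (gamma_source Gamma x) x.

Lemma gamma_source_linear (Gamma : forall p, H p -> H p) :
  (forall p, linear (Gamma p)) -> linear (gamma_source Gamma).
Proof. by move=> lG; do 2![apply: hsum_op_linear => ?]; exact: lG. Qed.

Lemma gamma_range_linear (Gamma : forall p, H p -> H p) :
  (forall p, linear (Gamma p)) -> linear (gamma_range Gamma).
Proof. by move=> lG; do 2![apply: hsum_op_linear => ?]; exact: lG. Qed.

Lemma adjoint_quadratic (Gamma : forall p, H p -> H p) x :
  hdot (adjoint M (gamma_range Gamma (M x))) x = hdot (gamma_range Gamma (M x)) (M x).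
Proof.
have fS := finite_dim_HS hH.
have [_ adj] := adjoint_dot fS (finite_dim_bounded fS lM).
by rewrite hdot_conj -adj -hdot_conj.
Qed.

Lemma lmi_operator_linear (c : R) (Gamma : forall p, H p -> H p) :
  (forall p, linear (Gamma p)) ->
  linear (fun x => adjoint M (gamma_range Gamma (M x)) - c%:C *: gamma_source Gamma x).
Proof.
move=> lG; have fS := finite_dim_HS hH.
have [[lA _] _] := adjoint_dot fS (finite_dim_bounded fS lM).
move=> a x y.
rewrite lM (gamma_range_linear lG) lA (gamma_source_linear lG).
rewrite scalerBr scalerDr opprD addrACA !scalerA [a * _]mulrC.
by [].
Qed.

(** The pointwise strict inequality must become a uniform gap. The defect [N] is itself positive
    definite, so it is factored in turn and compared with [Y]. *)
Lemma mu_hat_lt (t : R) (Gamma : forall p, H p -> H p) : 0 < t ->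
  (forall p, posdef_op (Gamma p)) -> lmi_at t Gamma ->
  mu_hat (Delta_G (H := H)) M < t.
Proof.
move=> t0 Gpos lmi; have fS := finite_dim_HS hH; have fR := finite_dim_HR hH.
have lG p : linear (Gamma p) by have [[]] := Gpos p.
pose LP p := cid (posdef_factor (Gpos p) (hH p)).
pose L p := projT1 (LP p); pose LP' p := cid (projT2 (LP p)); pose L' p := projT1 (LP' p).
have iL p : inverse_op (L p) (L' p) by have [] := projT2 (LP' p).
have GL p x : hdot (Gamma p x) x = `|L p x| ^+ 2 by have [] := projT2 (LP' p).
have lL p : linear (L p) by have [[]] := iL p.
pose X := gamma_range L; pose Y := gamma_source L; pose Y' := gamma_source L'.
have iX : inverse_op X (gamma_range L').
  apply: hsum_op_inverse => p; try (apply: finite_dim_hsum => _; exact: hH).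
  by apply: hsum_op_inverse.
have iY : inverse_op Y Y'.
  apply: hsum_op_inverse => p; try (apply: finite_dim_hsum => _; exact: hH).
  by apply: hsum_op_inverse.
have GX x : hdot (gamma_range Gamma x) x = `|X x| ^+ 2.
  by do 2![apply: hsum_op_dot => ? ?]; exact: GL.
have GY x : hdot (gamma_source Gamma x) x = `|Y x| ^+ 2.
  by do 2![apply: hsum_op_dot => ? ?]; exact: GL.
pose N x := - (adjoint M (gamma_range Gamma (M x)) - (t ^+ 2)%:C *: gamma_source Gamma x).
have NE x : hdot (N x) x = (t ^+ 2)%:C * `|Y x| ^+ 2 - `|X (M x)| ^+ 2.
  rewrite /N opprB linearBl/= linearZl_LR/= adjoint_quadratic GX.
  by rewrite GY.
have Npos : posdef_op N.
  split; first apply: finite_dim_bounded => //.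
    move=> a x y; rewrite /N (lmi_operator_linear _ lG).
    by rewrite opprD scalerN.
  by move=> x /lmi; rewrite GX GY NE subr_gt0.
have [F [F' [[_ bF' FK _] NF]]] := posdef_factor Npos fS.
have [bY bY' YK Y'K] := iY.
have [c c0 Yc] := bounded_opP (bounded_comp bF' bY).
(* Since [Y] is bounded by [c] times the factor [F] of [N], the form of [N] is at least [c ^- 2]
   times the squared norm of [Y x]. *)
have key x : `|X (M x)| ^+ 2 <= (t ^+ 2 - c ^- 2)%:C * `|Y x| ^+ 2.
  have YF : Y x = (Y \o F') (F x) by rewrite /= FK.
  have := Yc (F x); rewrite -YF -(@ler_pXn2r _ 2)// ?nnegrE ?mulr_ge0 ?ler0c ?(ltW c0)//.
  rewrite exprMn -NF NE -ler_pdivrMl; last by rewrite exprn_gt0// ltr0c.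
  rewrite lerBrDl -lerBrDr rmorphB/= mulrBl -!rmorphXn fmorphV/=.
  by [].
(* The difference can be negative only if the source space is zero; the maximum covers that case. *)
pose d := Num.max 0 (t ^+ 2 - c ^- 2); pose r := Num.sqrt d.
have d0 : 0 <= d by rewrite le_max lexx.
have r0 : 0 <= r by exact: sqrtr_ge0.
have rt : r < t.
  rewrite -(@ltr_pXn2r _ 2)// ?nnegrE ?(ltW t0)// sqr_sqrtr// gt_max exprn_gt0//=.
  by rewrite gtrDl oppr_lt0 invr_gt0 exprn_gt0.
have lX : linear X by have [[]] := iX.
have lY' : linear Y' by have [] := bY'.
apply: le_lt_trans rt; apply: (@le_trans _ _ (opnorm (X \o M \o Y'))).
  apply: ge_inf; last by exists X, (gamma_range L'), Y, Y'; split=> //; exact: gamma_commutant.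
  exists 0 => _ [X1 [X2 [Y1 [Y2 [_ [bX1 _ _ _] [_ bY2 _ _] ->]]]]].
  apply: opnorm_ge0; apply: bounded_comp => //; apply: bounded_comp => //.
  exact: finite_dim_bounded.
apply: opnorm_le => //; first by move=> a u w /=; rewrite lY' lM lX.
move=> u; rewrite -(@ler_pXn2r _ 2)// ?nnegrE ?mulr_ge0 ?ler0c//.
apply: (le_trans (key (Y' u))); rewrite Y'K exprMn ler_wpM2r ?exprn_ge0//.
by rewrite -rmorphXn/= sqr_sqrtr// lecR le_max lexx orbT.
Qed.

End Scaling.

(** * Destabilizing operators from duality *)

Section Duality.
Variables (R : realType) (G : bipartite_graph) (K : hilbertType R).
Hypothesis hK : ~ finite_dim K.
Variables (H : component G -> hilbertType R) (hH : forall p, finite_dim (H p)).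
Variable T : forall p, hilbert_tensor K (H p).
Variables (M : HS H -> HR H) (lM : linear M) (t : R) (t0 : 0 < t).
Variables (n : component G -> nat) (e : forall p, 'I_(n p) -> H p).
Hypothesis eb : forall p, is_onb (@e p).

(* [None] indexes a slack vector: its Gram matrix is the positive semidefinite
   defect in the operator inequality that Douglas' lemma needs. *)
Let Z : hilbertType R := hsum (fun p => hsum (fun _ : option (comp_source p) => H p)).

Let xpart (z : Z) : HS H := fun p s => z p (Some s).

Let xpart_linear : linear xpart.
Proof. by []. Qed.

Let coord p i (g : H p) : R[i] := hdot g (@e p i).

Let index := {p : component G & ('I_(n p) * 'I_(n p))%type}.

Let ix p (ij : 'I_(n p) * 'I_(n p)) : index := existT _ p ij.

Let prodc (k : index) (g g' : H (tag k)) : R[i] :=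
  coord (tagged k).1 g * Num.conj (coord (tagged k).2 g').

(** For [k = (p, (i, j))], the polarized [(i, j)] entry on component [p] of the slack plus [t ^+ 2]
    times the partial trace of [Q] minus that of [M Q M^*]. The sums of all [B k] over a family
    vanish exactly when these matrices balance. *)
Let B (k : index) (z z' : Z) : R[i] :=
  @prodc k (z (tag k) None) (z' (tag k) None)
  + (t ^+ 2)%:C * (\sum_(s : comp_source (tag k))
      @prodc k (z (tag k) (Some s)) (z' (tag k) (Some s)))
  - \sum_(r : comp_range (tag k)) @prodc k (@M (xpart z) (tag k) r) (@M (xpart z') (tag k) r).

Let prodcl k g a x y : @prodc k (a *: x + y) g = a * @prodc k x g + @prodc k y g.
Proof. by rewrite /prodc /coord linearPl mulrDl mulrA. Qed.

Let prodcr k g a x y : @prodc k g (a *: x + y) = Num.conj a * @prodc k g x + @prodc k g y.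
Proof. by rewrite /prodc /coord linearPl rmorphD rmorphM mulrDr mulrCA. Qed.

Let Bl k z a x y : B k (a *: x + y) z = a * B k x z + B k y z.
Proof.
rewrite /B xpart_linear lM.
under eq_bigr do rewrite !hsum_addE !hsum_scaleE prodcl.
under [X in _ - X]eq_bigr do rewrite !hsum_addE !hsum_scaleE prodcl.
rewrite !hsum_addE !hsum_scaleE prodcl !big_split /= -!mulr_sumr.
ring.
Qed.

Let Br k z a x y : B k z (a *: x + y) = Num.conj a * B k z x + B k z y.
Proof.
rewrite /B xpart_linear lM.
under eq_bigr do rewrite !hsum_addE !hsum_scaleE prodcr.
under [X in _ - X]eq_bigr do rewrite !hsum_addE !hsum_scaleE prodcr.
rewrite !hsum_addE !hsum_scaleE prodcr !big_split /= -!mulr_sumr.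
ring.
Qed.

Section Multiplier.
Variable v : index -> R[i].

Let vform p (g : H p) : R[i] :=
  \sum_(ij : 'I_(n p) * 'I_(n p)) v (ix ij) * (coord ij.1 g * Num.conj (coord ij.2 g)).

Let ReD (x y : R[i]) : complex.Re (x + y) = complex.Re x + complex.Re y.
Proof. by case: x y => [? ?] []. Qed.

Let Re_sum (I : finType) (f : I -> R[i]) : complex.Re (\sum_i f i) = \sum_i complex.Re (f i).
Proof. exact: (big_morph (@complex.Re R) ReD erefl). Qed.

Let vform_sum z : \sum_k complex.Re (v k * B k z z) =
  \sum_p (complex.Re (vform (z p None))
    + t ^+ 2 * (\sum_s complex.Re (vform (z p (Some s))))
    - \sum_r complex.Re (vform (@M (xpart z) p r))).
Proof.
rewrite -Re_sum.
have -> : \sum_k v k * B k z z = \sum_p (vform (z p None)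
    + (t ^+ 2)%:C * (\sum_s vform (z p (Some s)))
    - \sum_r vform (@M (xpart z) p r)).
  transitivity (\sum_p \sum_(ij : 'I_(n p) * 'I_(n p)) v (ix ij) * B (ix ij) z z).
    rewrite (sig_big_dep (fun=> true) (fun _ _ => true) (fun p ij => v (ix ij) * B (ix ij) z z)).
    by apply: eq_bigr => -[p ij].
  apply: eq_bigr => p _; rewrite /B /=.
  under eq_bigr do rewrite mulrBr mulrDr [v _ * (_%:C * _)]mulrCA !mulr_sumr.
  rewrite sumrB big_split /=; congr (_ + _ - _); last exact: exchange_big.
  rewrite exchange_big mulr_sumr; apply: eq_bigr => s _.
  by rewrite mulr_sumr.
rewrite Re_sum; apply: eq_bigr => p _.
rewrite -!Re_sum; case: (vform (z p None)) => a1 b1.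
case: (\sum_s _) => a2 b2; case: (\sum_r _) => a3 b3 /=.
by rewrite mul0r subr0.
Qed.

(** The Hermitian part of the multiplier matrix, whose quadratic form is the real part of
    [vform]. *)
Let Gamma p (g : H p) : H p :=
  \sum_j (\sum_i (v (ix (i, j)) + Num.conj (v (ix (j, i)))) / 2 * coord i g) *: @e p j.

Let Gamma_linear p : linear (@Gamma p).
Proof.
move=> a x y; rewrite /Gamma scaler_sumr -big_split; apply: eq_bigr => j _ /=.
rewrite scalerA -scalerDl mulr_sumr -big_split; congr (_ *: _).
by apply: eq_bigr => i _ /=; rewrite /coord linearPl mulrDr mulrCA.
Qed.

Let Gamma_dot p (g : H p) : hdot (Gamma g) g = (complex.Re (vform g))%:C.
Proof.
have -> : vform g = \sum_i \sum_j v (ix (i, j)) * (coord i g * Num.conj (coord j g)).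
  by rewrite pair_bigA; apply: eq_bigr => -[i j].
set S := \sum_i _; rewrite ReJ_add -[S^*%C]/(Num.conj S) /S.
rewrite rmorph_sum /= exchange_big /= -big_split /= mulr_suml hdot_suml.
apply: eq_bigr => j _; rewrite rmorph_sum -big_split /= mulr_suml linearZl_LR /= mulr_suml.
apply: eq_bigr => i _; rewrite !rmorphM /=. rewrite (hdot_conj (e j)) -/(coord j g).
set c := coord j g; have -> : Num.conj (Num.conj (coord i g)) = coord i g by exact: conjCK.
by field.
Qed.

Let vform0 p : vform (0 : H p) = 0.
Proof. by rewrite /vform big1// => ij _; rewrite /coord hdot0l mul0r mulr0. Qed.

(** Vectors [z] supported on a single slack slot give positive definiteness; vectors with zero slack
    give the inequality. *)
Lemma multiplier_lmi :
  (forall z : Z, z != 0 -> 0 < \sum_k complex.Re (v k * B k z z)) ->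
  (forall p, posdef_op (@Gamma p)) /\ lmi_at M t Gamma.
Proof.
move=> vpos; split=> [p|x x0].
  split; first exact: finite_dim_bounded.
  move=> g g0; rewrite Gamma_dot ltr0c.
  pose z : Z := hsum_inj (i := p) (hsum_inj (X := fun _ => H p) (i := None) g).
  have zp : z p None = g by rewrite /z !hsum_inj_in.
  have z0 : z != 0 by apply: contraNneq g0 => z0; rewrite -zp z0.
  have xz : xpart z = 0.
    apply: functional_extensionality_dep => q; apply: functional_extensionality_dep => s.
    rewrite /xpart /z; have [pq|pq] := eqVneq p q; last by rewrite hsum_inj_out.
    by case: _ / pq s => s; rewrite hsum_inj_in hsum_inj_out.
  have Z0 q (h : H q) : h = 0 -> complex.Re (vform h) = 0 by move=> ->; rewrite vform0.
  have := vpos z z0; rewrite vform_sum xz (linear_fun0 lM) (bigD1 p)//= zp.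
  rewrite [X in _ < _ + X]big1 => [|q qp]; last first.
    rewrite Z0 ?add0r; last by rewrite /z hsum_inj_out 1?eq_sym.
    rewrite !big1 ?mulr0 ?subr0// => u _; apply: Z0 => //.
    by rewrite -[z q _]/(@xpart z q u) xz.
  rewrite addr0 big1 => [|s _]; last by apply: Z0; rewrite -[z p _]/(@xpart z p s) xz.
  by rewrite mulr0 addr0 big1 ?subr0// => r _; exact: Z0.
pose z : Z := fun p o => if o is Some s then x p s else 0.
have xz : xpart z = x by [].
have z0 : z != 0 by apply: contraNneq x0 => z0; rewrite -xz z0.
have := vpos z z0; rewrite vform_sum xz.
rewrite -ltcR !hdot_hsum mulr_sumr -subr_gt0 -sumrB.
congr (_ < _); rewrite rmorph_sum; apply: eq_bigr => p _ /=.
rewrite vform0 /= add0r rmorphB rmorphM !rmorph_sum !hdot_hsum.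
congr (_ * _ - _); apply: eq_bigr => u _; by rewrite [RHS]Gamma_dot.
Qed.

End Multiplier.
Section CommonZero.
Variables (N : nat) (z : 'I_N -> Z).
Hypothesis z0 : exists j, z j != 0.
Hypothesis zB : forall k, \sum_j B k (z j) (z j) = 0.

Let x j : HS H := xpart (z j).

(** If all [x j] vanished, the diagonal equations would make the squared slack coordinates sum to
    zero, and the whole family would vanish. *)
Let x_neq0 : exists j, x j != 0.
Proof.
apply: contrapT => /forallNP x0; have [j /eqP[]] := z0.
have {}x0 i : x i = 0 by apply/eqP/negPn/negP/x0.
apply: functional_extensionality_dep => p; apply: functional_extensionality_dep => -[s|].
  by rewrite -[LHS]/(@x j p s) x0.
have zc i : coord i (@z j p None) = 0.
  have := zB (ix (i, i)); rewrite /B /=.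
  under eq_bigr => l _.
    rewrite -/(x l) x0 (linear_fun0 lM) big1 => [|s _]; last first.
      by rewrite -[@z l p (Some s)]/(@x l p s) x0 /prodc /coord hdot0l mul0r.
    rewrite mulr0 addr0 big1 => [|r _]; last by rewrite /prodc /coord hdot0l mul0r.
    rewrite subr0 /prodc /= -normCK.
    over.
  move=> /psumr_eq0P -/(_ _ j isT) zj; apply/eqP; rewrite -normr_eq0 -sqrf_eq0.
  by rewrite zj// => l _; rewrite exprn_ge0.
by rewrite [LHS](eb p).2 big1// => i _; rewrite -/(coord i _) zc scale0r.
Qed.

Variable kap : 'I_N -> K.
Hypothesis kapo : orthonormal_fam hdot kap.

(** [eta], [xi] and [ups] are the coefficients along [e i] of the image under [M], of [x] and of the
    slack. As [kap] is orthonormal, [zB] becomes the Gram identity [gram]; dropping the slack there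
    gives the hypothesis of [douglas]. *)
Let eta p i : KRp K p := fun r => \sum_j coord i (@M (x j) p r) *: kap j.
Let xi p i : KSp K p := fun s => \sum_j coord i (@x j p s) *: kap j.
Let ups p (i : 'I_(n p)) : K := \sum_j coord i (@z j p None) *: kap j.

Let gram p (i i' : 'I_(n p)) : hdot (eta i) (eta i') =
  (t ^+ 2)%:C * hdot (xi i) (xi i') + hdot (ups i) (ups i').
Proof.
have := zB (ix (i, i')); rewrite /B /= sumrB big_split /= => /eqP.
rewrite subr_eq0 => /eqP zE.
rewrite !hdot_hsum; under eq_bigr do rewrite orthonormal_dot//.
rewrite exchange_big /= -[LHS]zE addrC [ups i]/(ups i) orthonormal_dot//; congr (_ + _).
rewrite -mulr_sumr exchange_big /=; congr (_ * _).
by apply: eq_bigr => s _; rewrite orthonormal_dot.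
Qed.

Let comb_dot (X : hilbertType R) (I : finType) (c : I -> R[i]) (v : I -> X) :
  `|\sum_i c i *: v i| ^+ 2 = \sum_i \sum_j c i * Num.conj (c j) * hdot (v i) (v j).
Proof.
rewrite -hdot_norm hdot_suml; apply: eq_bigr => i _.
rewrite linearZl_LR/= hdot_sumr mulr_sumr; apply: eq_bigr => j _.
by rewrite linearZr_LR/= mulrA.
Qed.

Let interp p (c : 'I_(n p) -> R[i]) :
  `|\sum_i c i *: xi i| <= (t^-1)%:C * `|\sum_i c i *: eta i|.
Proof.
rewrite fmorphV/= mulrC ler_pdivlMr ?ltr0c// mulrC.
rewrite -(@ler_pXn2r _ 2)// ?nnegrE ?mulr_ge0 ?ler0c ?(ltW t0)// exprMn -rmorphXn/=.
have -> : `|\sum_i c i *: eta i| ^+ 2 =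
    (t ^+ 2)%:C * `|\sum_i c i *: xi i| ^+ 2 + `|\sum_i c i *: ups i| ^+ 2.
  rewrite !comb_dot mulr_sumr -big_split; apply: eq_bigr => i _ /=.
  rewrite mulr_sumr -big_split; apply: eq_bigr => j _ /=.
  by rewrite gram mulrDr [_ * (_%:C * _)]mulrCA.
by rewrite lerDl exprn_ge0.
Qed.

Let tens_coord p (h : 'I_N -> H p) : \sum_j tens (T p) (kap j) (h j) =
  \sum_i tens (T p) (\sum_j coord i (h j) *: kap j) (@e p i).
Proof.
under eq_bigr do rewrite (tens_expand _ _ _ (eb p)).
by rewrite exchange_big; apply: eq_bigr => i _; rewrite linear_sumlz.
Qed.

Lemma common_zero_radius : exists D, [/\ Delta_Gbar (T := T) D, bounded_op D,
  opnorm D <= t^-1 & spectrum (tensor_op (tensor_HS T) (tensor_HR T) idfun M \o D) 1].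
Proof.
have ti0 : 0 <= t^-1 by rewrite invr_ge0 ltW.
pose WP p := cid (douglas ti0 (@interp p)).
pose W p := projT1 (WP p).
have lW p : linear (W p) by have [] := projT2 (WP p).
have cW p : forall y, `|W p y| <= (t^-1)%:C * `|y| by have [] := projT2 (WP p).
have WE p i : W p (eta i) = xi i by have [_ _] := projT2 (WP p); exact.
have bW p : bounded_op (W p) by exact: linear_bounded_op (lW p) (cW p).
pose D := hsum_op (fun p => op_tensor_id (T := T) (W p)) : KHR T -> KHS T.
have DG : Delta_Gbar D by exists W.
have lD := Delta_Gbar_linear hH DG.
have cD y : `|D y| <= (t^-1)%:C * `|y| by exact: Delta_Gbar_le.
exists D; split=> //; first exact: linear_bounded_op lD cD.
  exact: opnorm_le.
pose xx : KHS T := \sum_j tens (tensor_HS T) (kap j) (x j).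
pose yy : KHR T := \sum_j tens (tensor_HR T) (kap j) (M (x j)).
have [[lMK _] ME] := id_tensor_opP (tensor_HS T) (tensor_HR T) (finite_dim_HS hH) lM.
have MK : tensor_op (tensor_HS T) (tensor_HR T) idfun M xx = yy.
  by rewrite /xx (linear_fun_sum lMK); apply: eq_bigr => j _; rewrite ME.
have Dy : D yy = xx.
  apply: functional_extensionality_dep => p; rewrite /D /hsum_op.
  have [lDp DpE] := op_tensor_idP hH T (bW p).
  have -> : yy p = \sum_i tens (tensor_suml (fun _ => T p)) (eta i) (@e p i).
    apply: functional_extensionality_dep => r; rewrite /yy !hsum_sumE.
    exact: (tens_coord (fun j => @M (x j) p r)).
  rewrite (linear_fun_sum lDp); under eq_bigr do rewrite DpE WE.
  apply: functional_extensionality_dep => s; rewrite /xx !hsum_sumE.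
  exact: esym (tens_coord (fun j => @x j p s)).
have xx0 : xx != 0.
  have [j xj] := x_neq0.
  rewrite -normr_eq0 -sqrf_eq0 norm_tens_suml// psumr_eq0 => [|i _]; last by rewrite exprn_ge0.
  apply/allPn; exists j; first by rewrite mem_index_enum.
  by rewrite sqrf_eq0 normr_eq0.
(* [yy] is a fixed vector of the loop operator, and it is nonzero because [D] maps it to [xx]. *)
case=> B0 [_ [lB _] BK _].
have := BK yy; rewrite /= Dy MK scale1r subrr (linear_fun0 lB) => y0.
by move: xx0; rewrite -Dy -y0 (linear_fun0 lD) eqxx.
Qed.

End CommonZero.

Lemma lmi_or_radius_onb :
  (exists2 Gamma : forall p, H p -> H p, forall p, posdef_op (Gamma p) & lmi_at M t Gamma) \/
  exists D, [/\ Delta_Gbar (T := T) D, bounded_op D,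
    opnorm D <= t^-1 & spectrum (tensor_op (tensor_HS T) (tensor_HR T) idfun M \o D) 1].
Proof.
have fZ : finite_dim Z by do 2![apply: finite_dim_hsum => ?]; exact: hH.
have [[N [z [z0 zB]]]|[v vpos]] := hermitian_alternative Bl Br fZ; last first.
  by left; have [Gpos lmi] := multiplier_lmi vpos; eexists; [exact: Gpos | exact: lmi].
right; have [kap kapo] := infinite_orthonormal hK N.
exact: (common_zero_radius z0 zB kapo).
Qed.

End Duality.

Lemma lmi_or_radius (R : realType) (G : bipartite_graph) (K : hilbertType R)
    (H : component G -> hilbertType R) (T : forall p, hilbert_tensor K (H p))
    (M : HS H -> HR H) (t : R) :
  ~ finite_dim K -> (forall p, finite_dim (H p)) -> linear M -> 0 < t ->
  (exists2 Gamma : forall p, H p -> H p, forall p, posdef_op (Gamma p) & lmi_at M t Gamma) \/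
  exists D, [/\ Delta_Gbar (T := T) D, bounded_op D,
    opnorm D <= t^-1 & spectrum (tensor_op (tensor_HS T) (tensor_HR T) idfun M \o D) 1].
Proof.
move=> hK hH lM t0.
have [n nP] := boolp.choice (fun p => finite_dim_onb (hH p)).
pose e p : 'I_(n p) -> H p := projT1 (cid (nP p)).
have eb p : is_onb (@e p) := projT2 (cid (nP p)).
exact: (lmi_or_radius_onb hK hH T lM t0 eb).
Qed.

(** * Comparison of the two bounds *)

Section Comparison.
Variables (R : realType) (G : bipartite_graph) (K : hilbertType R).
Variables (H : component G -> hilbertType R) (hH : forall p, finite_dim (H p)).
Variables (T : forall p, hilbert_tensor K (H p)) (M : HS H -> HR H) (lM : linear M).

Let MK := tensor_op (tensor_HS T) (tensor_HR T) idfun M.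

Lemma Delta_Gbar_bounded D : Delta_Gbar (T := T) D -> bounded_op D.
Proof.
move=> DG; have lD := Delta_Gbar_linear hH DG; have [W bW DE] := DG.
have c p : exists2 c : R, 0 < c & forall x, `|W p x| <= c%:C * `|x| := bounded_opP (bW p).
pose d p := projT1 (cid2 (c p)).
have d0 p : 0 < d p by rewrite /d; case: cid2.
have dW p x : `|W p x| <= (\sum_p d p)%:C * `|x|.
  apply: (@le_trans _ _ ((d p)%:C * `|x|)); first by rewrite /d; case: cid2.
  rewrite ler_wpM2r// lecR (bigD1 p)//= lerDl sumr_ge0// => q _; exact: ltW.
apply: (@linear_bounded_op _ _ _ _ (\sum_p d p)) => // x; rewrite DE.
apply: Delta_Gbar_le => // [p|]; first by have [] := bW p.
by apply: sumr_ge0 => p _; exact: ltW.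
Qed.

Lemma radius_scaling D X X' Y Y' : Delta_Gbar (T := T) D -> spectrum (MK \o D) 1 ->
  commutant (Delta_G (H := H)) (X, Y) -> inverse_op X X' -> inverse_op Y Y' ->
  1 <= opnorm (X \o M \o Y') * opnorm D.
Proof.
by move=> DG sp XY iX iY; apply: scaling_bound XY iX iY sp => //; exact: Delta_Gbar_bounded.
Qed.

Lemma commutant_id : commutant (Delta_G (H := H)) (idfun, idfun).
Proof. by split; [exact: bounded_idfun | exact: bounded_idfun|]. Qed.

Lemma inverse_idfun (X : hilbertType R) : inverse_op (idfun : X -> X) idfun.
Proof. by split=> //; exact: bounded_idfun. Qed.

(** The trivial scaling. It keeps the infimum in [mu] away from zero, where the inverse would take
    its default value 0. *)
Lemma radius_lower D : Delta_Gbar (T := T) D -> spectrum (MK \o D) 1 ->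
  1 <= opnorm M * opnorm D.
Proof.
move=> DG sp.
exact: (radius_scaling DG sp commutant_id (inverse_idfun _) (inverse_idfun _)).
Qed.

Lemma mu_tilde_ge0 : 0 <= mu_tilde T M.
Proof.
rewrite /mu_tilde /mu; case: asboolP => // /eqP/set0P r0.
rewrite invr_ge0; apply: lb_le_inf => // _ [D [DG _] <-].
exact/opnorm_ge0/Delta_Gbar_bounded.
Qed.

Lemma mu_tilde_le : mu_tilde T M <= mu_hat (Delta_G (H := H)) M.
Proof.
apply: lb_le_inf.
  (* The identity scaling shows that the infimum in [mu_hat] is over a nonempty set. *)
  exists (opnorm (idfun \o M \o idfun)), idfun, idfun, idfun, idfun.
  split=> //; [exact: commutant_id | exact: inverse_idfun | exact: inverse_idfun].
move=> _ [X [X' [Y [Y' [XY iX iY ->]]]]]; set rho := opnorm _.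
have rho0 : 0 <= rho.
  have [bX _ _ _] := iX; have [_ bY' _ _] := iY.
  apply: opnorm_ge0; apply: bounded_comp => //; apply: bounded_comp => //.
  exact: finite_dim_bounded (finite_dim_HS hH) lM.
rewrite /mu_tilde /mu; case: asboolP => // /eqP/set0P r0.
have [_ [D0 [DG0 sp0] _]] := r0.
have {}rho0 : 0 < rho.
  rewrite lt_def rho0 andbT; apply/eqP => r; have := radius_scaling DG0 sp0 XY iX iY.
  by rewrite -/rho r mul0r ler10.
rewrite -[leRHS]invrK lef_pV2 ?posrE ?invr_gt0//; last first.
  apply: lt_le_trans (_ : rho^-1 <= _); first by rewrite invr_gt0.
  apply: lb_le_inf => // _ [D [DG sp] <-].
  by rewrite -[leLHS]mul1r ler_pdivrMr// mulrC; exact: radius_scaling XY iX iY.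
apply: lb_le_inf => // _ [D [DG sp] <-].
by rewrite -[leLHS]mul1r ler_pdivrMr// mulrC; exact: radius_scaling XY iX iY.
Qed.

Lemma mu_tilde_ge (t : R) D : 0 < t -> Delta_Gbar (T := T) D -> opnorm D <= t^-1 ->
  spectrum (MK \o D) 1 -> t <= mu_tilde T M.
Proof.
move=> t0 DG Dt sp; rewrite /mu_tilde /mu; case: asboolP => [r0|/eqP/set0P r0].
  by suff : set0 (opnorm D) by []; rewrite -r0; exists D.
have M0 : 0 < opnorm M.
  rewrite lt_def opnorm_ge0 ?andbT; last exact: finite_dim_bounded (finite_dim_HS hH) lM.
  by apply/eqP => m0; have := radius_lower DG sp; rewrite m0 mul0r ler10.
have lb : (opnorm M)^-1 <= inf (singular_radii (Delta_Gbar (T := T)) MK).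
  apply: lb_le_inf => // _ [D' [DG' sp'] <-].
  by rewrite -[leLHS]mul1r ler_pdivrMr// mulrC; exact: radius_lower.
rewrite -[leLHS]invrK lef_pV2 ?posrE ?invr_gt0//; last first.
  by apply: lt_le_trans lb; rewrite invr_gt0.
apply: le_trans Dt; apply: ge_inf; last by exists D.
by exists 0 => _ [D' [DG' _] <-]; exact/opnorm_ge0/Delta_Gbar_bounded.
Qed.

Lemma mu_tilde_lmi (t : R) : ~ finite_dim K -> 0 < t -> mu_tilde T M < t ->
  exists2 Gamma : forall p, H p -> H p, forall p, posdef_op (Gamma p) & lmi_at M t Gamma.
Proof.
move=> hK t0 lt; have [//|[D [DG _ Dt sp]]] := lmi_or_radius T hK hH lM t0.
by move: lt; rewrite ltNge (mu_tilde_ge t0 DG Dt sp).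
Qed.

End Comparison.

Theorem theorem3p2 (R : realType) (G : bipartite_graph)
    (hG : complete_bipartite_components G)
    (K : hilbertType R) (hKinf : ~ finite_dim K) (hKsep : separable_space K)
    (H : component G -> hilbertType R) (hH : forall p, finite_dim (H p))
    (T : forall p, hilbert_tensor K (H p))
    (M : {linear HS H -> HR H}) :
  [/\ mu_tilde T M = mu_hat (@Delta_G R G H) M,
      mu_tilde T M < 1 <-> mu_hat (@Delta_G R G H) M < 1 &
      mu_tilde T M < 1 <->
        exists2 Gamma : forall p, H p -> H p,
          forall p, posdef_op (Gamma p) &
          negdef_op (fun x : HS H =>
            adjoint M (gamma_range Gamma (M x)) - gamma_source Gamma x)].
Proof.
have lM : linear M by move=> a x y; rewrite linearP.
have le1 := mu_tilde_le hH T lM.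
have eq : mu_tilde T M = mu_hat (@Delta_G R G H) M.
  (* A strict inequality would allow the level [t = mu_hat], positive because [mu_tilde] is
     nonnegative; the resulting [Gamma] would give [mu_hat < mu_hat]. *)
  apply/le_anti; rewrite le1 /= leNgt; apply/negP => lt.
  have hat0 := le_lt_trans (mu_tilde_ge0 hH T M) lt.
  have [Gamma Gpos lmi] := mu_tilde_lmi hH lM hKinf hat0 lt.
  by have := mu_hat_lt hH lM hat0 Gpos lmi; rewrite ltxx.
split=> //; first by rewrite eq.
have formE (Gamma : forall p, H p -> H p) (x : HS H) :
    hdot (adjoint M (gamma_range Gamma (M x)) - gamma_source Gamma x) x =
    hdot (gamma_range Gamma (M x)) (M x) - hdot (gamma_source Gamma x) x.
  by rewrite linearBl /= adjoint_quadratic.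
split=> [lt|[Gamma Gpos [_ neg]]].
  have [Gamma Gpos lmi] := mu_tilde_lmi hH lM hKinf ltr01 lt.
  exists Gamma => //; split=> [|x /lmi].
    have lG p : linear (Gamma p) by have [[]] := Gpos p.
    apply: finite_dim_bounded; first exact: finite_dim_HS.
    have := lmi_operator_linear hH lM 1 lG.
    by under eq_fun do rewrite scale1r.
  by rewrite formE subr_lt0 expr1n mul1r.
rewrite eq; apply: mu_hat_lt ltr01 Gpos _ => // x /neg.
by rewrite formE subr_lt0 expr1n mul1r.
Qed.
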